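(* Let $\alpha:I\to\mathbb{E}_1^{2k+1}$ be a non-null self-similar curve with constant p-shape curvatures $\tilde\kappa_1\ne0,\tilde\kappa_2\neq0,\dots,\tilde\kappa_{2k}\ne0$. Suppose that $\lambda_1^2,\lambda_2^2,\dots,\lambda_k^2$ are all different eigenvalues of the symmetric matrix $M^2$, where $M$ is the constant $(2k+1)\times(2k+1)$ matrix given in the context. Put $$b_1=\sqrt{\lambda_1^2-\tilde\kappa_1^2},\quad \theta_1=\lambda_1\sigma-\cosh^{-1}\!\left(\frac{\lambda_1}{\sqrt{\lambda_1^2-\tilde\kappa_1^2}}\right),\qquad b_i=\sqrt{\lambda_i^2+\tilde\kappa_1^2},\quad \theta_i=\lambda_i\sigma+\cos^{-1}\!\left(\frac{\lambda_i}{\sqrt{\lambda_i^2+\tilde\kappa_1^2}}\right)\ (i=2,\dots,k).$$ (i) If the unit vector $\mathbf{e}_1$ is timelike, then a parametric statement of the timelike self-similar curve $\alpha$ according to the spherical arc length parameter $\sigma$ can be written in the form $$\alpha(\sigma)=e^{\tilde\kappa_1\sigma}\Big(\tfrac{a_1}{b_1}\sinh\theta_1,\ \tfrac{a_1}{b_1}\cosh\theta_1,\ \tfrac{a_2}{b_2}\sin\theta_2,\ -\tfrac{a_2}{b_2}\cos\theta_2,\ \dots,\ \tfrac{a_k}{b_k}\sin\theta_k,\ -\tfrac{a_k}{b_k}\cos\theta_k,\ a_{k+1}\Big),$$ where the real different non-zero numbers $a_1,\dots,a_k,a_{k+1}$ are a solution of the system of $k+1$ algebraic quadratic equations $$\mathbf{e}_1\cdot\mathbf{e}_1=-1,\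 \text{ or } -a_1^2+\sum_{i=2}^ka_i^2+\tilde\kappa_1^2a_{k+1}^2=-1;\qquad \mathbf{e}_2\cdot\mathbf{e}_2=1,\ \text{ or } \sum_{i=1}^ka_i^2\lambda_i^2=1;$$ $$\mathbf{e}_3\cdot\mathbf{e}_3=1,\ \text{ or } -a_1^2(1-\lambda_1^2)^2+\sum_{i=2}^k(1+\lambda_i^2)^2a_i^2+\tilde\kappa_1^2a_{k+1}^2=\tilde\kappa_2^2;\qquad \mathbf{e}_i\cdot\mathbf{e}_i=1,\ i=4,\dots,k+1,$$ determined by the vectors $$\mathbf{e}_1=e^{-\tilde\kappa_1\sigma}\frac{d\alpha}{d\sigma},\quad \mathbf{e}_2=\frac{d\mathbf{e}_1}{d\sigma},\quad \mathbf{e}_3=\frac1{\tilde\kappa_2}\Big(-\mathbf{e}_1+\frac{d\mathbf{e}_2}{d\sigma}\Big),\quad \mathbf{e}_4=\frac1{\tilde\kappa_3}\Big(\tilde\kappa_2\mathbf{e}_2+\frac{d\mathbf{e}_3}{d\sigma}\Big),\ \dots,\ \mathbf{e}_{k+1}=\frac1{\tilde\kappa_k}\Big(\tilde\kappa_{k-1}\mathbf{e}_{k-1}+\frac{d\mathbf{e}_k}{d\sigma}\Big).$$ (ii) If the unit vector $\mathbf{e}_2$ is timelike, then a parametric representation of the spacelike self-similar curve $\alpha$ according to the spherical arc length parameter $\sigma$ can be written in the form $$\alpha(\sigma)=e^{\tilde\kappa_1\sigma}\Big(-\tfrac{a_1}{b_1}\cosh\theta_1,\ -\tfrac{a_1}{b_1}\sinh\theta_1,\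 \tfrac{a_2}{b_2}\sin\theta_2,\ -\tfrac{a_2}{b_2}\cos\theta_2,\ \dots,\ \tfrac{a_k}{b_k}\sin\theta_k,\ -\tfrac{a_k}{b_k}\cos\theta_k,\ a_{k+1}\Big),$$ where the real different non-zero numbers $a_1,\dots,a_k,a_{k+1}$ are a solution of the system of $k+1$ algebraic quadratic equations $$\mathbf{e}_1\cdot\mathbf{e}_1=1,\ \text{ or } \sum_{i=1}^ka_i^2+\tilde\kappa_1^2a_{k+1}^2=1;\qquad \mathbf{e}_2\cdot\mathbf{e}_2=-1,\ \text{ or } -a_1^2\lambda_1^2+\sum_{i=2}^ka_i^2\lambda_i^2=-1;$$ $$\mathbf{e}_3\cdot\mathbf{e}_3=1,\ \text{ or } a_1^2(1-\lambda_1^2)^2+\sum_{i=2}^k(1+\lambda_i^2)^2a_i^2+\tilde\kappa_1^2a_{k+1}^2=\tilde\kappa_2^2;\qquad \mathbf{e}_i\cdot\mathbf{e}_i=1,\ i=4,\dots,k+1,$$ determined by the vectors $$\mathbf{e}_1=e^{-\tilde\kappa_1\sigma}\frac{d\alpha}{d\sigma},\quad \mathbf{e}_2=-\frac{d\mathbf{e}_1}{d\sigma},\quad \mathbf{e}_3=\frac1{\tilde\kappa_2}\Big(\mathbf{e}_1+\frac{d\mathbf{e}_2}{d\sigma}\Big),\quad \mathbf{e}_4=\frac1{\tilde\kappa_3}\Big(-\tilde\kappa_2\mathbf{e}_2+\frac{d\mathbf{e}_3}{d\sigma}\Big),\ \dots,\ \mathbf{e}_{k+1}=\frac1{\tilde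\kappa_k}\Big(\tilde\kappa_{k-1}\mathbf{e}_{k-1}+\frac{d\mathbf{e}_k}{d\sigma}\Big).$$
   Context: $\mathbb{E}_1^n$ is $\mathbb{R}^n$ with the Lorentzian inner product $\mathbf{x}\cdot\mathbf{y}=\mathbf{x}^TI^*\mathbf{y}$, $I^*=\mathrm{diag}(-1,1,\dots,1)$; here $n=2k+1$. A p-similarity is a map $f(x)=\mu\mathbf{A}x+\mathbf{b}$ with $\mu\ne0$ real, $\mathbf{A}$ pseudo-orthogonal ($\mathbf{A}^TI^*\mathbf{A}=I^*$) with $\det\mathbf{A}=1$, $\mathbf{b}\in\mathbb{R}^n$; these form the group $\mathbf{Sim}(\mathbb{E}_1^n)$. A non-null curve with arc length $s$ is equipped with a Frenet frame: a pseudo-orthonormal frame $\mathbf{e}_1,\dots,\mathbf{e}_n$ with $\mathbf{e}_1=d\alpha/ds$, $\varepsilon_\ell=\mathbf{e}_\ell\cdot\mathbf{e}_\ell\in\{\pm1\}$, satisfying $$\mathbf{e}_1'=\varepsilon_2\kappa_1\mathbf{e}_2,\quad \mathbf{e}_i'=-\varepsilon_{i-1}\kappa_{i-1}\mathbf{e}_{i-1}+\varepsilon_{i+1}\kappa_i\mathbf{e}_{i+1}\ (2\le i\le n-1),\quad \mathbf{e}_n'=-\varepsilon_{n-1}\kappa_{n-1}\mathbf{e}_{n-1},$$ where $'=d/ds$, $\kappa_j>0$ for $1\le j\le n-2$ and $\kappa_{n-1}\neq0$. A spherical arc length parameter $\sigma$ is an arc length parameter of $s\mapsto\mathbf{e}_1(s)$,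 so $d\sigma=\kappa_1ds$. The p-shape curvatures are $\tilde\kappa_1=-\frac1{\kappa_1}\frac{d\kappa_1}{d\sigma}$ and $\tilde\kappa_i=\frac{\kappa_i}{\kappa_1}$ for $i=2,\dots,n-1$. A non-null curve $\alpha$ is self-similar if there is a one-parameter subgroup $G$ of $\mathbf{Sim}(\mathbb{E}_1^n)$ such that every $f\in G$ preserves $\alpha$ globally and $G$ acts transitively on $\alpha$; this means that all its p-shape curvatures are constant. $M$ is the constant tridiagonal $n\times n$ matrix with zero diagonal, superdiagonal entries $M_{12}=\varepsilon_2$, $M_{i,i+1}=\varepsilon_{i+1}\tilde\kappa_i$ $(2\le i\le n-1)$, and subdiagonal entries $M_{21}=-\varepsilon_1$, $M_{i+1,i}=-\varepsilon_i\tilde\kappa_i$ $(2\le i\le n-1)$; thus $\frac{d}{d\sigma}(\mathbf{e}_1,\dots,\mathbf{e}_n)^T=M(\mathbf{e}_1,\dots,\mathbf{e}_n)^T$.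
   Formalization: For i≥2 the eigenvalues of M² are −λ_i² with λ_i≠0 (M² has at most one positive eigenvalue); λ_1>0 and λ_1²>κ̃_1² so that b_1, θ_1 exist; the a_i are pairwise different except where three or more |a_i| coincide (can occur); α has the stated form up to a p-similarity. *)

(* Defs.v *)
(* MathComp / MathComp-Analysis *)
From HB Require Import structures.
From mathcomp Require Import all_boot all_order all_algebra.
From mathcomp Require Import all_classical all_reals all_analysis.

Set Implicit Arguments.
Unset Strict Implicit.
Unset Printing Implicit Defensive.

Import Order.TTheory GRing.Theory Num.Theory.
Import numFieldNormedType.Exports.

Local Open Scope classical_set_scope.
Local Open Scope ring_scope.

(* Families e_i, kappa_i, eps_i, a_i, lambda_i are indexed by [nat] starting
   from 1, as in the mathematics; values outside the stated range are never
   used.  The space E_1^N is ['cV[R]_n.+1] with N = n.+1; its time axis is the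
   coordinate of index 0. *)

Definition lorentz_mx (R : realType) (n : nat) : 'M[R]_n.+1 :=
  diag_mx (\row_j (if j == 0 then -1 else 1)).

Definition ldot (R : realType) (n : nat) (x y : 'cV[R]_n.+1) : R :=
  (x^T *m lorentz_mx R n *m y) 0 0.

Record psim (R : realType) (n : nat) := Psim {
  psim_ratio : R;
  psim_mx : 'M[R]_n.+1;
  psim_vec : 'cV[R]_n.+1;
  psim_ratio_neq0 : psim_ratio != 0;
  psim_mx_pseudo_orthogonal :
    psim_mx^T *m lorentz_mx R n *m psim_mx = lorentz_mx R n;
  psim_mx_det : \det psim_mx = 1 }.

Definition psim_act (R : realType) (n : nat) (f : psim R n)
    (x : 'cV[R]_n.+1) : 'cV[R]_n.+1 :=
  psim_ratio f *: (psim_mx f *m x) + psim_vec f.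

(* A continuous homomorphism from (R, +) to the group of p-similarities; an
   affine map depends continuously on t iff its value at every point does. *)
Definition one_parameter_subgroup (R : realType) (n : nat) (f : R -> psim R n) :=
  (forall t u x, psim_act (f (t + u)) x = psim_act (f t) (psim_act (f u) x)) /\
  (forall x, continuous (fun t => psim_act (f t) x)).

Definition self_similar (R : realType) (n : nat) (I : set R)
    (alpha : R -> 'cV[R]_n.+1) :=
  exists f : R -> psim R n,
    [/\ one_parameter_subgroup f,
        forall t, psim_act (f t) @` (alpha @` I) = alpha @` I &
        forall p q, (alpha @` I) p -> (alpha @` I) q ->
          exists t, psim_act (f t) p = q].

(* [alpha] is parametrized by arc length s in [I]. *)
Record frenet_curve (R : realType) (n : nat) (I : set R)
    (alpha : R -> 'cV[R]_n.+1) (e : nat -> R -> 'cV[R]_n.+1)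
    (eps : nat -> R) (kappa : nat -> R -> R) : Prop := FrenetCurve {
  frenet_eps : forall i, (1 <= i <= n.+1)%N -> eps i = 1 \/ eps i = -1;
  frenet_orthonormal : forall s i j, I s ->
    (1 <= i <= n.+1)%N -> (1 <= j <= n.+1)%N ->
    ldot (e i s) (e j s) = if i == j then eps i else 0;
  frenet_tangent : forall s, I s -> is_derive s 1 alpha (e 1%N s);
  frenet_first : forall s, I s ->
    is_derive s 1 (e 1%N) ((eps 2%N * kappa 1%N s) *: e 2%N s);
  frenet_middle : forall s i, I s -> (2 <= i <= n)%N ->
    is_derive s 1 (e i)
      (- (eps i.-1 * kappa i.-1 s) *: e i.-1 s
       + (eps i.+1 * kappa i s) *: e i.+1 s);
  frenet_last : forall s, I s ->
    is_derive s 1 (e n.+1) (- (eps n * kappa n s) *: e n s);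
  frenet_curvature_gt0 : forall s j, I s -> (1 <= j <= n.-1)%N ->
    0 < kappa j s;
  frenet_torsion_neq0 : forall s, I s -> kappa n s != 0;
  frenet_curvature1_derivable : forall s, I s -> derivable (kappa 1%N) s 1 }.

Definition arc_length_parameter (R : realType) (n : nat) (I : set R)
    (gamma : R -> 'cV[R]_n.+1) (sigma : R -> R) :=
  forall s, I s ->
    is_derive s 1 sigma
      (Num.sqrt `|ldot (derive1 gamma s) (derive1 gamma s)|).

(* p-shape curvatures as functions of s; d kappa_1 / d sigma is the quotient
   of the derivatives with respect to s. *)
Definition shape_curvature (R : realType) (kappa : nat -> R -> R)
    (sigma : R -> R) (i : nat) (s : R) : R :=
  if i == 1%N then
    - (kappa 1%N s)^-1 * (derive1 (kappa 1%N) s / derive1 sigma s)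
  else kappa i s / kappa 1%N s.

(* kappa_i / kappa_1 for all i >= 1, given the p-shape curvatures [kt] *)
Definition curvature_ratio (R : realType) (kt : nat -> R) (i : nat) : R :=
  if i == 1%N then 1 else kt i.

(* Rows and columns are numbered from 0 here: the entry of 1-based indices
   (p, q) is the one at (p - 1, q - 1). *)
Definition frenet_mx (R : realType) (n : nat) (eps kt : nat -> R) :
    'M[R]_n.+1 :=
  \matrix_(i < n.+1, j < n.+1)
    if j == i.+1 :> nat then eps j.+1 * curvature_ratio kt i.+1
    else if i == j.+1 :> nat then - (eps j.+1 * curvature_ratio kt j.+1)
    else 0.

Definition coshR (R : realType) (x : R) : R := (expR x + expR (- x)) / 2.
Definition sinhR (R : realType) (x : R) : R := (expR x - expR (- x)) / 2.

(* inverse of [coshR : [0, +oo[ -> [1, +oo[] *)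
Definition acoshR (R : realType) (x : R) : R := ln (x + Num.sqrt (x ^+ 2 - 1)).

Definition spiral_b (R : realType) (kt lam : nat -> R) (i : nat) : R :=
  if i == 1%N then Num.sqrt (lam 1%N ^+ 2 - kt 1%N ^+ 2)
  else Num.sqrt (lam i ^+ 2 + kt 1%N ^+ 2).

Definition spiral_theta (R : realType) (kt lam : nat -> R) (i : nat)
    (sigma : R) : R :=
  if i == 1%N then lam 1%N * sigma - acoshR (lam 1%N / spiral_b kt lam 1%N)
  else lam i * sigma + acos (lam i / spiral_b kt lam i).

(* The coordinates x0, x1 are followed by the pairs
   (a_i / b_i) sin theta_i, - (a_i / b_i) cos theta_i at the (0-based)
   positions 2 (i - 1), 2 (i - 1) + 1 for 2 <= i <= k, and by a_{k+1}. *)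
Definition spiral (R : realType) (k : nat) (kt lam a : nat -> R)
    (x0 x1 : R -> R) (sigma : R) : 'cV[R]_(k.*2.+1) :=
  expR (kt 1%N * sigma) *: \col_(j < k.*2.+1)
    if j == 0%N :> nat then x0 sigma
    else if j == 1%N :> nat then x1 sigma
    else if j == k.*2 :> nat then a k.+1
    else let i := j./2.+1 in
      if odd j then - (a i / spiral_b kt lam i * cos (spiral_theta kt lam i sigma))
      else a i / spiral_b kt lam i * sin (spiral_theta kt lam i sigma).

Definition timelike_spiral (R : realType) (k : nat) (kt lam a : nat -> R) :
    R -> 'cV[R]_(k.*2.+1) :=
  spiral k kt lam a
    (fun sigma => a 1%N / spiral_b kt lam 1%N * sinhR (spiral_theta kt lam 1%N sigma))
    (fun sigma => a 1%N / spiral_b kt lam 1%N * coshR (spiral_theta kt lam 1%N sigma)).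

Definition spacelike_spiral (R : realType) (k : nat) (kt lam a : nat -> R) :
    R -> 'cV[R]_(k.*2.+1) :=
  spiral k kt lam a
    (fun sigma => - (a 1%N / spiral_b kt lam 1%N * coshR (spiral_theta kt lam 1%N sigma)))
    (fun sigma => - (a 1%N / spiral_b kt lam 1%N * sinhR (spiral_theta kt lam 1%N sigma))).

(* The vectors e_1, e_2, ... computed from a curve [gamma] parametrized by
   sigma, where eps_m = -1 and the other signs are 1:
     e_1     = exp(- kt_1 sigma) gamma',
     e_2     = eps_2 e_1',
     e_{j+1} = (1 / kt_j) (eps_{j-1} r_{j-1} e_{j-1} + e_j'),  j >= 2,
   with r_1 = 1 and r_i = kt_i for i >= 2 (and p = j - 1 in the code). *)
Fixpoint spiral_frame (R : realType) (n m : nat) (kt : nat -> R)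
    (gamma : R -> 'cV[R]_n.+1) (i : nat) : R -> 'cV[R]_n.+1 :=
  let eps (l : nat) : R := if l == m then -1 else 1 in
  match i with
  | 0%N => fun=> 0
  | 1%N => fun sigma => expR (- kt 1%N * sigma) *: derive1 gamma sigma
  | (p.+1 as j).+1 => fun sigma =>
      let e'j := derive1 (spiral_frame m kt gamma j) sigma in
      if p is 0%N then eps 2%N *: e'j
      else (kt j)^-1 *:
        ((eps p * curvature_ratio kt p) *: spiral_frame m kt gamma p sigma + e'j)
  end.

Definition timelike_system (R : realType) (k : nat) (kt lam a : nat -> R) :=
  let e := spiral_frame 1%N kt (timelike_spiral k kt lam a) in
  [/\ (forall i sigma, (1 <= i <= k.+1)%N ->
         ldot (e i sigma) (e i sigma) = if i == 1%N then -1 else 1),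
      - a 1%N ^+ 2 + \sum_(2 <= i < k.+1) a i ^+ 2
        + kt 1%N ^+ 2 * a k.+1 ^+ 2 = -1,
      \sum_(1 <= i < k.+1) a i ^+ 2 * lam i ^+ 2 = 1 &
      - a 1%N ^+ 2 * (1 - lam 1%N ^+ 2) ^+ 2
        + \sum_(2 <= i < k.+1) (1 + lam i ^+ 2) ^+ 2 * a i ^+ 2
        + kt 1%N ^+ 2 * a k.+1 ^+ 2 = kt 2%N ^+ 2].

Definition spacelike_system (R : realType) (k : nat) (kt lam a : nat -> R) :=
  let e := spiral_frame 2%N kt (spacelike_spiral k kt lam a) in
  [/\ (forall i sigma, (1 <= i <= k.+1)%N ->
         ldot (e i sigma) (e i sigma) = if i == 2%N then -1 else 1),
      \sum_(1 <= i < k.+1) a i ^+ 2 + kt 1%N ^+ 2 * a k.+1 ^+ 2 = 1,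
      - a 1%N ^+ 2 * lam 1%N ^+ 2
        + \sum_(2 <= i < k.+1) a i ^+ 2 * lam i ^+ 2 = -1 &
      a 1%N ^+ 2 * (1 - lam 1%N ^+ 2) ^+ 2
        + \sum_(2 <= i < k.+1) (1 + lam i ^+ 2) ^+ 2 * a i ^+ 2
        + kt 1%N ^+ 2 * a k.+1 ^+ 2 = kt 2%N ^+ 2].

(* The quadratic systems determine a_1, ..., a_{k+1} only up to signs, which
   can be chosen freely.  If three or more of them have the same absolute value
   (which does occur), no choice of signs makes them pairwise different; this
   says that they are pairwise different apart from that case. *)
Definition different_up_to_triples (R : realType) (m : nat) (a : nat -> R) :=
  forall i j, (1 <= i <= m)%N -> (1 <= j <= m)%N -> i <> j -> a i = a j ->
    exists l, [/\ (1 <= l <= m)%N, l <> i, l <> j & `|a l| = `|a i|].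

(* Main.v *)
(* The matrix M is antisymmetric for the form diag(eps), which has exactly one
   negative sign.  Each eigenspace of M^2 for a nonzero eigenvalue has dimension
   at least 2, so together with ker M they fill the space and e_1 is a sum of
   mutually orthogonal eigenvectors u_i.  A real eigenvector of M for
   +-lambda_1 is null and orthogonal to u_i for i >= 2, so these u_i are
   spacelike; the squares of the u_i are the numbers +-a_i^2
   (kt_1^2 a_{k+1}^2 for the kernel).
   The derivatives of exp(- kt_1 sigma) gamma', for gamma the explicit spiral,
   then have the same Gram matrix as e_1, e_1 M, e_1 M^2, ..., hence the same
   linear recursion turns them into a frame that is pseudo-orthonormal with
   signs eps and satisfies the Frenet equations of alpha.  The linear map
   taking the frame of alpha to this one is constant along the curve. *)
Require Import Defs.
From HB Require Import structures.
From mathcomp Require Import all_boot all_order all_algebra.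
From mathcomp Require Import all_classical all_reals all_analysis.
From mathcomp Require Import zify ring lra.

Set Implicit Arguments.
Unset Strict Implicit.
Unset Printing Implicit Defensive.

Import Order.TTheory GRing.Theory Num.Theory.
Import numFieldNormedType.Exports.

Local Open Scope classical_set_scope.
Local Open Scope ring_scope.

(** * Diagonal forms with one negative sign *)

(** The quadratic system is never solved. Its unknowns are read off from the spectrum: the squares
    of the components of e_1 in the eigenspaces of M^2 satisfy all the norm equations at once, and
    the difficulty is to show that they have the signs that real non-zero amplitudes require.
    Antisymmetry makes the product of the a-th and b-th derivatives of e_1 depend, up to sign, only
    on a + b, and vanish for a + b odd. The Gram matrix is thus a list of moments of weights placed
    at the eigenvalues, and a spiral with one plane per nonzero eigenvalue and one axis for the
    kernel has the same moments. The dimension bound for the eigenspaces rests on a parity: M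
    couples only neighbouring indices, hence anticommutes with the diagonal matrix of alternating
    signs. *)

Section LorentzSum.
Variables (R : realFieldType) (T : finType) (d : T -> R) (p : T).
Hypotheses (d_p : d p = -1) (d_other : forall j, j != p -> d j = 1).
Implicit Types u v z : T -> R.

Lemma lorentz_sumE u v :
  \sum_j d j * (u j * v j) = - (u p * v p) + \sum_(j | j != p) u j * v j.
Proof.
rewrite (bigD1 p) //= d_p mulN1r; congr (_ + _).
by apply: eq_bigr => j jp; rewrite d_other // mul1r.
Qed.

Lemma lorentz_ge0 u : u p = 0 -> 0 <= \sum_j d j * (u j * u j).
Proof.
move=> up0; rewrite lorentz_sumE up0 mul0r oppr0 add0r.
by apply: sumr_ge0 => j _; rewrite -expr2 sqr_ge0.
Qed.

Lemma lorentz_eq0 u : u p = 0 -> \sum_j d j * (u j * u j) <= 0 ->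
  forall j, u j = 0.
Proof.
move=> up0; rewrite lorentz_sumE up0 mul0r oppr0 add0r => le0 j.
have [->//|jp] := eqVneq j p.
have ge0 i : i != p -> 0 <= u i * u i by move=> _; rewrite -expr2 sqr_ge0.
have /eqP : \sum_(i | i != p) u i * u i = 0.
  by apply/le_anti; rewrite le0 sumr_ge0.
by rewrite psumr_eq0 // => /allP/(_ j (mem_index_enum _)); rewrite jp /=
   -expr2 sqrf_eq0 => /eqP.
Qed.

Lemma lorentz_sum_sqr u v (s t : R) :
  \sum_j d j * ((s * u j - t * v j) * (s * u j - t * v j)) =
  s ^+ 2 * (\sum_j d j * (u j * u j)) - (s * t) *+ 2 * (\sum_j d j * (u j * v j))
    + t ^+ 2 * (\sum_j d j * (v j * v j)).
Proof.
by rewrite !mulr_sumr -sumrB -big_split; apply: eq_bigr => j _ /=; ring.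
Qed.

(* The combination of u and v with vanishing p-coordinate is spacelike. *)
Lemma timelike_not_orthogonal u v :
  \sum_j d j * (u j * u j) < 0 -> \sum_j d j * (v j * v j) < 0 ->
  \sum_j d j * (u j * v j) != 0.
Proof.
move=> uu vv; apply/eqP => uv.
pose x j := v p * u j - u p * v j.
have x0 : x p = 0 by rewrite /x mulrC subrr.
have := lorentz_ge0 x0.
rewrite lorentz_sum_sqr uv mulr0 subr0.
have [up0|up0] := eqVneq (u p) 0; first by move: uu; rewrite ltNge lorentz_ge0.
rewrite leNgt => /negP; apply.
by rewrite -[X in _ < X]addr0 ler_ltD // ?pmulr_rlt0 ?mulr_ge0_le0 ?sqr_ge0 ?(ltW uu) //
  lt0r sqrf_eq0 up0 sqr_ge0.
Qed.

(** Subtracting the multiple of [z] that cancels the coordinate [p] does not change the square of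
    [u], because [z] is null and orthogonal to [u]. The difference lies where the form is positive
    definite and has square at most 0, so it vanishes. *)
Lemma orthogonal_null_collinear u z :
  \sum_j d j * (z j * z j) = 0 -> (exists j, z j != 0) ->
  \sum_j d j * (u j * z j) = 0 -> \sum_j d j * (u j * u j) <= 0 ->
  exists c, forall j, u j = c * z j.
Proof.
move=> zz [i zi] uz uu.
have zp : z p != 0.
  apply/eqP => zp; move: zi; rewrite (lorentz_eq0 zp) ?eqxx //.
  by rewrite zz.
exists (u p / z p) => j.
pose x j := 1 * u j - (u p / z p) * z j.
have x0 : x p = 0 by rewrite /x divfK // mul1r subrr.
suff : x j = 0 by rewrite /x mul1r => /eqP; rewrite subr_eq0 => /eqP.
apply: lorentz_eq0 => //.
by rewrite lorentz_sum_sqr uz zz !mulr0 subr0 addr0 expr1n mul1r.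
Qed.

End LorentzSum.

(** * The Frenet matrix and its Krylov vectors *)

Section FrenetMatrix.
Variables (R : realType) (n : nat) (eps kt : nat -> R).
Hypothesis eps_sqr : forall i, (1 <= i <= n.+1)%N -> eps i * eps i = 1.
Local Notation r := (curvature_ratio kt).
Local Notation M := (frenet_mx n eps kt).
Implicit Types x y z : 'rV[R]_n.+1.

(** A row [x] stands for the combination of the Frenet vectors with coefficients [x]; this is their
    Lorentzian product in these coordinates. *)
Definition frame_dot x y := \sum_(j < n.+1) eps j.+1 * (x 0 j * y 0 j).
Local Notation dot := frame_dot.

(** The index is a [nat] so that the row is 0 beyond [n], which lets the last Frenet equation have
    the same form as the others. *)
Definition frame_unit (i : nat) : 'rV[R]_n.+1 := \row_j (j == i :> nat)%:R.
Local Notation del := frame_unit.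

Lemma frame_dotC x y : dot x y = dot y x.
Proof. by apply: eq_bigr => j _; rewrite (mulrC (x 0 j)). Qed.

Lemma frame_dotDl x y z : dot (x + y) z = dot x z + dot y z.
Proof. by rewrite -big_split; apply: eq_bigr => j _ /=; rewrite mxE; ring. Qed.

Lemma frame_dotZl a x z : dot (a *: x) z = a * dot x z.
Proof. by rewrite mulr_sumr; apply: eq_bigr => j _ /=; rewrite mxE; ring. Qed.

Lemma frame_dot0l z : dot 0 z = 0.
Proof. by rewrite -(scale0r 0) frame_dotZl mul0r. Qed.

Lemma frame_dot_suml (T : finType) (f : T -> 'rV[R]_n.+1) z :
  dot (\sum_i f i) z = \sum_i dot (f i) z.
Proof.
exact: (big_morph (fun x => dot x z) (fun x y => frame_dotDl x y z)
  (frame_dot0l z)).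
Qed.

Lemma frame_dot_unit (i : 'I_n.+1) x : dot (del i) x = eps i.+1 * x 0 i.
Proof.
rewrite /dot (bigD1 i) //= big1 ?addr0 => [|j ji]; rewrite mxE.
  by rewrite eqxx mul1r.
by rewrite val_eqE (negPf ji) mul0r mulr0.
Qed.

Lemma frenet_mx_skew (i j : 'I_n.+1) :
  eps j.+1 * M i j = - (eps i.+1 * M j i).
Proof.
have Hi := ltn_ord i; have Hj := ltn_ord j; rewrite !mxE.
have [ji|ji] := eqVneq (j : nat) i.+1.
  have -> : (i == j.+1 :> nat) = false by apply/eqP; lia.
  by rewrite ji mulrN opprK !mulrA !eps_sqr // -ji.
have [ij|ij] := eqVneq (i : nat) j.+1; last by rewrite !mulr0 oppr0.
by rewrite ij mulrN !mulrA !eps_sqr // -ij.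
Qed.

Lemma frame_dot_skew x y : dot (x *m M) y = - dot x (y *m M).
Proof.
rewrite /dot -sumrN.
under eq_bigr do rewrite mxE mulr_suml mulr_sumr.
rewrite exchange_big; apply: eq_bigr => i _ /=.
rewrite mxE mulr_sumr mulr_sumr -sumrN; apply: eq_bigr => j _.
have -> : eps j.+1 * (x 0 i * M i j * y 0 j) =
  eps j.+1 * M i j * (x 0 i * y 0 j) by ring.
by rewrite frenet_mx_skew; ring.
Qed.

(** The Frenet equations in coordinates. The [if] removes the term that [i.-1] would wrongly produce
    at [i = 0]. *)
Lemma frame_unit_mul i : (i <= n)%N -> del i *m M =
  (eps i.+2 * r i.+1) *: del i.+1 - (if i is j.+1 then eps i * r i else 0) *: del i.-1.
Proof.
move=> le_in; have -> : del i = delta_mx 0 (inord i : 'I_n.+1).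
  apply/rowP => j; rewrite !mxE eqxx /=; congr (_%:R).
  by rewrite -val_eqE /= inordK.
rewrite -rowE; apply/rowP => j; rewrite !mxE inordK //.
case: i le_in => [|i] le_in.
  by rewrite mul0r subr0; case: eqVneq => [->|_]; rewrite ?mulr1 ?mulr0.
rewrite /= eqSS.
have [->|j1] := eqVneq (j : nat) i.+2.
  by rewrite mulr1 [i.+2 == i](_ : _ = false) ?mulr0 ?subr0 //; apply/eqP; lia.
by rewrite eq_sym; case: eqVneq => [->|_]; rewrite !(mulr1, mulr0) sub0r ?oppr0.
Qed.

Lemma frame_dot_nondegenerate z :
  (forall i : 'I_n.+1, dot (del i) z = 0) -> z = 0.
Proof.
move=> z0; apply/rowP => i; rewrite mxE.
have Hi := ltn_ord i.
by rewrite -[LHS]mul1r -(@eps_sqr i.+1) // -mulrA -frame_dot_unit z0 mulr0.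
Qed.

End FrenetMatrix.

(* Solves e_j' = - (eps_(j-1) r_(j-1)) e_(j-1) + (c_j)^-1 e_(j+1) for e_(j+1):
   from e_1 and its derivatives [f b], [ladder i b] is the b-th derivative
   of e_i. *)
Fixpoint ladder (R : realType) (V : lmodType R) (eps r c : nat -> R)
    (f : nat -> V) (i : nat) : nat -> V :=
  match i with
  | 0%N => fun=> 0
  | 1%N => f
  | (p.+1 as j).+1 => fun b =>
      c j *: ((eps p * r p) *: ladder eps r c f p b + ladder eps r c f j b.+1)
  end.

Lemma nat_ind2 (P : nat -> Prop) :
  P 0%N -> P 1%N -> (forall i, P i -> P i.+1 -> P i.+2) -> forall i, P i.
Proof.
move=> P0 P1 P2 i; suff [] : P i /\ P i.+1 by [].
by elim: i => // i [Pi Pi1]; split => //; apply: P2.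
Qed.

Section Ladder.
Variables (R : realType) (eps r c : nat -> R).

(** A ladder is a combination of the [f b] whose coefficients do not depend on [f], so the Gram
    matrix of the derivatives of e_1 determines that of the whole frame. [step] treats one argument;
    symmetry gives the other. *)
Lemma ladder_gram (U V : lmodType R) (f : nat -> U) (g : nat -> V)
    (bu : U -> U -> R) (bv : V -> V -> R) :
  (forall x y z, bu (x + y) z = bu x z + bu y z) ->
  (forall a x z, bu (a *: x) z = a * bu x z) -> (forall x y, bu x y = bu y x) ->
  (forall x y z, bv (x + y) z = bv x z + bv y z) ->
  (forall a x z, bv (a *: x) z = a * bv x z) -> (forall x y, bv x y = bv y x) ->
  (forall a b, bu (f a) (f b) = bv (g a) (g b)) ->
  forall i j a b, bu (ladder eps r c f i a) (ladder eps r c f j b) =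
    bv (ladder eps r c g i a) (ladder eps r c g j b).
Proof.
move=> uD uZ uC vD vZ vC fg.
have u0 z : bu 0 z = 0 by rewrite -(scale0r 0) uZ mul0r.
have v0 z : bv 0 z = 0 by rewrite -(scale0r 0) vZ mul0r.
have step u v : (forall a, bu (f a) u = bv (g a) v) ->
    forall i a, bu (ladder eps r c f i a) u = bv (ladder eps r c g i a) v.
  move=> uv; apply: nat_ind2 => [a|//|i IH0 IH1 a]; first by rewrite u0 v0.
  by rewrite [LHS]uZ [RHS]vZ uD vD uZ vZ IH0 IH1.
move=> i j a b; apply: (step) => a'; rewrite uC vC; apply: (step) => b'.
by rewrite fg.
Qed.

End Ladder.

Section Krylov.
Variables (R : realType) (n : nat) (eps kt : nat -> R).
Hypothesis eps_sqr : forall i, (1 <= i <= n.+1)%N -> eps i * eps i = 1.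
Hypothesis kt_neq0 : forall i, (1 <= i <= n)%N -> kt i != 0.
Local Notation r := (curvature_ratio kt).
Local Notation M := (frenet_mx n eps kt).
Local Notation dot := (frame_dot eps).
Local Notation del := (frame_unit R n).
Local Notation c := (fun i => (eps i.+1 * r i)^-1).

(** Coordinates, in the Frenet frame, of the b-th derivative of e_1 with respect to sigma. *)
Definition krylov (b : nat) : 'rV[R]_n.+1 := del 0 *m M ^+ b.

Lemma ratio_neq0 i : (1 <= i <= n)%N -> eps i.+1 * r i != 0.
Proof.
move=> Hi; rewrite mulf_neq0 //.
  have : eps i.+1 * eps i.+1 = 1 by apply: eps_sqr; lia.
  by apply: contra_eq_neq => ->; rewrite mul0r eq_sym oner_eq0.
by rewrite /curvature_ratio; case: (i == 1%N); rewrite ?oner_neq0 ?kt_neq0.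
Qed.

Lemma ladder_krylov i b : (i <= n)%N ->
  ladder eps r c krylov i.+1 b = del i *m M ^+ b.
Proof.
elim/nat_ind2: i b => [//|b n_gt0|i IH0 IH1 b lt_in].
  rewrite /= scaler0 add0r /krylov exprS mulmxA frame_unit_mul //.
  by rewrite scale0r subr0 -scalemxAl scalerA mulVf ?scale1r // ratio_neq0.
have -> : ladder eps r c krylov i.+3 b =
  c i.+2 *: ((eps i.+1 * r i.+1) *: ladder eps r c krylov i.+1 b
    + ladder eps r c krylov i.+2 b.+1) by [].
rewrite IH0 ?IH1; [|lia..].
rewrite exprS mulmxA frame_unit_mul; last lia.
rewrite mulmxBl -!scalemxAl addrC subrK scalerA mulVf ?scale1r //.
by apply: ratio_neq0; lia.
Qed.

(** The last Frenet equation: the next rung would be a multiple of [del n.+1], which is 0. *)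
Lemma ladder_krylov_last b : (0 < n)%N ->
  (eps n * r n) *: ladder eps r c krylov n b + ladder eps r c krylov n.+1 b.+1 = 0.
Proof.
move=> n_gt0; have := ladder_krylov b (leq_pred n); rewrite prednK // => ->.
rewrite ladder_krylov //.
rewrite exprS mulmxA frame_unit_mul // mulmxBl -!scalemxAl.
have -> : del n.+1 = 0.
  by apply/rowP => j; rewrite !mxE; have := ltn_ord j; case: eqP => // ->; lia.
have -> : (if n is j.+1 then eps n * r n else 0) = eps n * r n.
  by case: (n) n_gt0.
by rewrite mul0mx scaler0 sub0r subrr.
Qed.

Lemma frame_dot_skew_exp a x y :
  dot (x *m M ^+ a) y = (-1) ^+ a * dot x (y *m M ^+ a).
Proof.
elim: a x y => [|a IH] x y; first by rewrite !expr0 !mulmx1 mul1r.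
have -> : y *m M ^+ a.+1 = y *m M ^+ a *m M by rewrite exprSr mulmxA.
by rewrite exprS mulmxA IH frame_dot_skew // exprS mulN1r mulrN mulNr.
Qed.

(** The vector e_1 is cyclic for M: the ladder expresses every [del i] through the Krylov vectors,
    and the form is nondegenerate. *)
Lemma krylov_nondegenerate z : (forall a, dot (krylov a) z = 0) -> z = 0.
Proof.
move=> z0; apply: (frame_dot_nondegenerate eps_sqr) => i.
rewrite -[del i]mulmx1 -[1%:M](expr0 M) -ladder_krylov; last by rewrite -ltnS.
suff h j b : dot (ladder eps r c krylov j b) z = 0 by exact: h.
elim/nat_ind2: j b => [b|b|j IH0 IH1 b]; last 1 first.
- by rewrite [LHS]frame_dotZl frame_dotDl frame_dotZl IH0 IH1 mulr0 addr0 mulr0.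
- exact: frame_dot0l.
- exact: z0.
Qed.

(** Each M moved across the form costs a sign. All of them can therefore be gathered on one side,
    and for an odd number the value equals its own opposite. *)
Lemma krylov_moment a b : dot (krylov a) (krylov b) =
  if odd (a + b) then 0
  else (-1) ^+ b * dot (del 0 *m (M ^+ 2) ^+ (a + b)./2) (del 0).
Proof.
have -> : dot (krylov a) (krylov b) = (-1) ^+ b * dot (krylov (a + b)) (del 0).
  rewrite frame_dotC /krylov frame_dot_skew_exp exprD mulmxA.
  by rewrite (frame_dotC _ (_ *m _)).
case: ifP => [odd_ab|/negbT even_ab]; last first.
  by rewrite /krylov -exprM mul2n even_halfK.
suff -> : dot (krylov (a + b)) (del 0) = 0 by rewrite mulr0.
have := frame_dot_skew_exp (a + b) (del 0) (del 0).
by rewrite -signr_odd odd_ab expr1 mulN1r (frame_dotC _ (del 0)) /krylov; lra.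
Qed.

End Krylov.

(** * Spectral decomposition of the first frame vector *)

Section Spectrum.
Variables (R : realType) (k : nat) (eps kt lam : nat -> R) (p : 'I_(k.*2.+1)).
Local Notation n := k.*2.
Hypotheses (k_ge1 : (1 <= k)%N) (eps_p : eps p.+1 = -1)
  (eps_other : forall j : 'I_n.+1, j != p -> eps j.+1 = 1).
Hypothesis kt_neq0 : forall i, (1 <= i <= n)%N -> kt i != 0.
Local Notation M := (frenet_mx n eps kt).
Local Notation dot := (frame_dot eps).
Local Notation del := (frame_unit R n).
Local Notation krylov := (krylov n eps kt).
Hypotheses
  (lam1_eigen : eigenvalue (M ^+ 2) (lam 1%N ^+ 2))
  (lam_eigen : forall i, (2 <= i <= k)%N -> eigenvalue (M ^+ 2) (- lam i ^+ 2))
  (lam_neq0 : forall i, (2 <= i <= k)%N -> lam i != 0)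
  (lam_different : forall i j, (2 <= i <= k)%N -> (2 <= j <= k)%N ->
       i <> j -> lam i ^+ 2 <> lam j ^+ 2)
  (lam1_neq0 : lam 1%N != 0).

(** The eigenvalues of M^2, numbered from 0 so that node [i] belongs to the coordinates [i.*2] and
    [i.*2.+1] of the spiral and node [k] to its last coordinate. Node [i] goes with the amplitude
    a_(i+1). *)
Definition spiral_node (i : nat) : R :=
  if i == 0%N then lam 1%N ^+ 2 else if i == k then 0 else - lam i.+1 ^+ 2.
Local Notation node := spiral_node.

Lemma signs_sqr i : (1 <= i <= n.+1)%N -> eps i * eps i = 1.
Proof.
case: i => // i Hi; have [e|ne] := eqVneq (Ordinal (Hi : (i < n.+1)%N)) p.
  by have := eps_p; rewrite -e /= => ->; rewrite mulrNN mulr1.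
by have /= -> := eps_other ne; rewrite mulr1.
Qed.
Local Notation eps_sqr := signs_sqr.

Lemma node_neq0 i : (i < k)%N -> node i != 0.
Proof.
move=> lt_ik; rewrite /node; have [_|i0] := eqVneq i 0%N; first by rewrite sqrf_eq0.
rewrite ltn_eqF // oppr_eq0 sqrf_eq0 lam_neq0 //; lia.
Qed.

Lemma node_lt0 i : (0 < i < k)%N -> node i < 0.
Proof.
move=> /andP[i0 lt_ik]; rewrite lt_neqAle node_neq0 //= /node.
by rewrite gtn_eqF // ltn_eqF // oppr_le0 sqr_ge0.
Qed.

(** Node 0 is positive, node [k] is 0 and those between are negative, so only the latter could
    coincide, which [lam_different] forbids. *)
Lemma node_inj i j : (i <= k)%N -> (j <= k)%N -> node i = node j -> i = j.
Proof.
move=> Hi Hj.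
have node0 : 0 < node 0 by rewrite /node eqxx lt0r sqrf_eq0 lam1_neq0 sqr_ge0.
have nodek : node k = 0 by rewrite /node eqxx gtn_eqF.
have pos m : (0 < m <= k)%N -> node m <= 0.
  move=> Hm; have [->|mk] := eqVneq m k; first by rewrite nodek.
  by apply/ltW/node_lt0; lia.
have pm m : (0 < m <= k)%N -> node 0 <> node m.
  by move=> /pos h e; move: node0; rewrite e ltNge h.
case: (posnP i) => [->|i0]; case: (posnP j) => [->|j0] //.
- by move/pm; rewrite j0 => /(_ Hj).
- by move/esym/pm; rewrite i0 => /(_ Hi).
have [->|ik] := eqVneq i k; have [->|jk] := eqVneq j k => //.
- by rewrite nodek => e; have := @node_lt0 j; rewrite -e ltxx; lia.
- by rewrite nodek => e; have := @node_lt0 i; rewrite e ltxx; lia.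
rewrite /node (gtn_eqF i0) (gtn_eqF j0) (negPf ik) (negPf jk) => /oppr_inj e.
case: (eqVneq i j) => // /eqP ij.
by exfalso; apply: (@lam_different i.+1 j.+1) => //; lia.
Qed.

Lemma node_ord_inj : injective (fun i : 'I_k.+1 => node i).
Proof.
by move=> i j e; apply/val_inj/node_inj; [exact: (ltn_ord i)|exact: (ltn_ord j)|].
Qed.

(* [M] is antisymmetric for the form [dot], and the dimension is odd. *)
Lemma frenet_mx_singular : \det M = 0.
Proof.
pose D : 'M[R]_n.+1 := diag_mx (\row_j eps j.+1).
have MD : M *m D = - (M *m D)^T.
  have E (i j : 'I_n.+1) : (M *m D) i j = eps j.+1 * M i j.
    by rewrite mul_mx_diag !mxE mulrC.
  apply/matrixP => i j; rewrite 2![in RHS]mxE !E; exact: (frenet_mx_skew _ eps_sqr).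
have := congr1 determinant MD.
have sgn : (-1) ^+ n.+1 = -1 :> R by rewrite -signr_odd /= odd_double expr1.
rewrite -scaleN1r detZ det_tr sgn mulN1r det_mulmx.
have D0 : \det D != 0.
  rewrite det_diag prodf_seq_neq0; apply/allP => j _ /=; rewrite mxE.
  have [->|/eps_other ->] := eqVneq j p; last exact: oner_neq0.
  by rewrite eps_p oppr_eq0 oner_neq0.
move/eqP; rewrite -addr_eq0 -mulr2n mulrn_eq0 /= mulf_eq0 (negPf D0) orbF.
by move/eqP.
Qed.

Lemma node_eigen i : (i <= k)%N -> eigenvalue (M ^+ 2) (node i).
Proof.
move=> le_ik; rewrite /node; have [//|i0] := eqVneq i 0%N.
have [_|ik] := eqVneq i k; last by apply: lam_eigen; lia.
have /det0P[v v0 vM] : \det M == 0 by rewrite frenet_mx_singular.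
by apply/eigenvalueP; exists v; rewrite // expr2 mulmxA vM mul0mx scale0r.
Qed.

Definition parity_mx : 'M[R]_n.+1 := diag_mx (\row_j (-1) ^+ j).
Local Notation S := parity_mx.

Lemma parity_mxE (x : 'rV[R]_n.+1) j : (x *m S) 0 j = x 0 j * (-1) ^+ j.
Proof. by rewrite mul_mx_diag !mxE. Qed.

Lemma parity_mxK (x : 'rV[R]_n.+1) : x *m S *m S = x.
Proof. by apply/rowP => j; rewrite !parity_mxE -mulrA -expr2 sqrr_sign mulr1. Qed.

Lemma parity_frenet_mx : M *m S = - (S *m M).
Proof.
rewrite mul_mx_diag mul_diag_mx; apply/matrixP => i j; rewrite !mxE.
case: eqP => [->|_]; first by rewrite exprS; ring.
by case: eqP => [->|_]; [rewrite exprS; ring|ring].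
Qed.

(* If an eigenvector [v] of [M ^+ 2] spans its eigenspace, then it is a common
   eigenvector of the anticommuting [M] and [S]. *)
Lemma rank_eigenspace_sqr a : a != 0 -> eigenvalue (M ^+ 2) a ->
  (1 < \rank (eigenspace (M ^+ 2) a))%N.
Proof.
move=> a0 /eigenvalueP[v vMM v0]; rewrite ltnNge; apply/negP => rank1.
have vE : (v <= eigenspace (M ^+ 2) a)%MS by apply/eigenspaceP.
have collinear x : x *m (M ^+ 2) = a *: x -> exists c, x = c *: v.
  move=> /eigenspaceP xE; apply/sub_rVP; apply: submx_trans xE _.
  rewrite -(mxrank_leqif_sup vE) eqn_leq mxrankS //=.
  by rewrite rank_rV v0.
have [c vM] : exists c, v *m M = c *: v.
  by apply: collinear; rewrite scalemxAl -vMM expr2 !mulmxA.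
have MS : M ^+ 2 *m S = S *m M ^+ 2.
  rewrite expr2 -mulmxA parity_frenet_mx mulmxN mulmxA parity_frenet_mx.
  by rewrite mulNmx opprK mulmxA.
have [t vS] : exists t, v *m S = t *: v.
  by apply: collinear; rewrite -mulmxA -MS mulmxA vMM scalemxAl.
have c0 : c != 0.
  apply: contra_neq v0 => c0; apply: (scalerI a0).
  by rewrite -vMM expr2 mulmxA vM c0 scale0r mul0mx scaler0.
have t0 : t != 0.
  by apply: contra_neq v0 => t0; rewrite -(parity_mxK v) vS t0 scale0r mul0mx.
(* Applied to [v], anticommutation gives c t = - c t, although neither scalar is 0. *)
have := congr1 (fun A => v *m A) parity_frenet_mx.
rewrite mulmxN !mulmxA vM vS -!scalemxAl vM vS !scalerA (mulrC t) => /eqP.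
rewrite -addr_eq0 -scalerDl scaler_eq0 (negPf v0) orbF.
by rewrite -mulr2n mulrn_eq0 /= mulf_eq0 (negPf c0) (negPf t0).
Qed.

Lemma sum_eigenspace_full :
  row_full (\sum_(i < k.+1) eigenspace (M ^+ 2) (node i))%MS.
Proof.
have dx : mxdirect (\sum_(i < k.+1) eigenspace (M ^+ 2) (node i)).
  by apply: mxdirect_sum_eigenspace => i j _ _; apply: node_ord_inj.
rewrite -col_leq_rank (mxdirectP dx) /= big_ord_recr /=.
apply: (@leq_trans (k * 2 + 1)%N); first by rewrite addn1 muln2.
rewrite leq_add //; last first.
  by rewrite lt0n mxrank_eq0; apply: node_eigen.
rewrite -[X in (X * _)%N]card_ord -sum_nat_const leq_sum // => i _.
by apply: rank_eigenspace_sqr; [apply: node_neq0|apply/node_eigen/ltnW].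
Qed.

Lemma frame_unit_decomposition : exists u : 'I_k.+1 -> 'rV[R]_n.+1,
  del 0 = \sum_i u i /\ forall i, u i *m M ^+ 2 = node i *: u i.
Proof.
have /sub_sumsmxP[u ->] :
    (del 0 <= \sum_(i < k.+1) eigenspace (M ^+ 2) (node i))%MS.
  exact/submx_full/sum_eigenspace_full.
exists (fun i => u i *m eigenspace (M ^+ 2) (node i)); split=> // i.
by apply/eigenspaceP; rewrite submxMl.
Qed.

Lemma frame_dot_sqr x y : dot (x *m M ^+ 2) y = dot x (y *m M ^+ 2).
Proof. by rewrite (frame_dot_skew_exp _ eps_sqr) expr2 mulrNN !mulr1 mul1r. Qed.

Lemma eigen_orthogonal a b x y : a != b ->
  x *m M ^+ 2 = a *: x -> y *m M ^+ 2 = b *: y -> dot x y = 0.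
Proof.
move=> ab xa yb; have := frame_dot_sqr x y.
rewrite xa yb (frame_dotC _ x) !frame_dotZl (frame_dotC _ y) => /eqP.
by rewrite -subr_eq0 -mulrBl mulf_eq0 subr_eq0 (negPf ab) => /eqP.
Qed.

(** Since M^2 - lam_1^2 factors, v M + lam_1 v is an eigenvector of M for lam_1, unless it is 0 and
    [v] itself is one for - lam_1. Antisymmetry then makes l times the square of [z] equal to its
    opposite. *)
Lemma null_eigenvector : exists (z : 'rV[R]_n.+1) (l : R),
  [/\ z != 0, l ^+ 2 = node 0, z *m M = l *: z & dot z z = 0].
Proof.
have [v vMM v0] := eigenvalueP lam1_eigen.
have [z [l [z0 l2 zM]]] : exists (z : 'rV[R]_n.+1) (l : R),
    [/\ z != 0, l ^+ 2 = node 0 & z *m M = l *: z].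
  have [e|e] := eqVneq (v *m M + lam 1%N *: v) 0.
    exists v, (- lam 1%N); rewrite sqrrN /node eqxx; split => //.
    by apply/eqP; rewrite scaleNr -addr_eq0 e.
  exists (v *m M + lam 1%N *: v), (lam 1%N); rewrite /node eqxx; split => //.
  rewrite mulmxDl -mulmxA -[(M *m M)%R]/(M ^+ 2) vMM scalerDr scalerA addrC.
  by rewrite -scalemxAl -expr2.
exists z, l; split => //.
have l0 : l != 0 by rewrite -sqrf_eq0 l2 node_neq0.
have := frame_dot_skew kt eps_sqr z z; rewrite zM frame_dotZl frame_dotC.
rewrite frame_dotZl => /eqP; rewrite -addr_eq0 -mulr2n mulrn_eq0 /= mulf_eq0.
by rewrite (negPf l0) => /eqP.
Qed.

(** The weight [w i] is the square of the component [u i] of e_1. The sign of [w 0] is left open,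
    because it differs between the timelike and the spacelike case. *)
Lemma spectral_weights : exists w : nat -> R,
  (forall i, (0 < i <= k)%N -> 0 < w i) /\
  forall a b, dot (krylov a) (krylov b) =
    if odd (a + b) then 0
    else (-1) ^+ b * \sum_(i < k.+1) node i ^+ (a + b)./2 * w i.
Proof.
have [u [del0E uM]] := frame_unit_decomposition.
have node_neq (i j : 'I_k.+1) : i != j -> node i != node j.
  by apply: contra_neq => /node_ord_inj.
(* If [u i] were 0, an eigenvector for node [i] would be orthogonal to all components of e_1, and so
   would its images under powers of M; cyclicity of e_1 would make it 0. *)
have u_neq0 i : u i != 0.
  have [v vMM v0] := eigenvalueP (node_eigen (ltn_ord i : (i <= k)%N)).
  apply: contra_neq v0 => ui0; apply: (krylov_nondegenerate eps_sqr kt_neq0) => a.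
  rewrite /krylov (frame_dot_skew_exp _ eps_sqr) del0E frame_dot_suml big1 ?mulr0 //.
  move=> j _; have [->|ji] := eqVneq j i; first by rewrite ui0 frame_dot0l.
  apply: (eigen_orthogonal (node_neq _ _ ji)) => //.
  have MC : M ^+ a *m M ^+ 2 = M ^+ 2 *m M ^+ a.
    by rewrite -[LHS]/(M ^+ a * M ^+ 2) -exprD addnC exprD.
  by rewrite -mulmxA MC mulmxA vMM scalemxAl.
have u_orth i j : i != j -> dot (u i) (u j) = 0.
  by move=> /node_neq ij; apply: (eigen_orthogonal ij).
exists (fun i => dot (u (inord i)) (u (inord i))); split=> [m m_k|a b].
  set i : 'I_k.+1 := inord m.
  have i0 : i != ord0 by rewrite -val_eqE /= /i inordK; lia.
  have [z [l [z0 l2 zM zz]]] := null_eigenvector.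
  have zMM : z *m M ^+ 2 = node 0 *: z.
    by rewrite expr2 mulmxA zM -scalemxAl zM scalerA -l2 expr2.
  (* A component of square at most 0, being orthogonal to the null vector [z], is a multiple of it
     and so belongs to node 0 as well as to node [i]. *)
  rewrite ltNge; apply/negP => ui_le0.
  have [||c uic] := orthogonal_null_collinear (d := fun j : 'I_n.+1 => eps j.+1) (p := p)
     eps_p eps_other (u := fun j => u i 0 j) zz _ _ ui_le0.
  - by apply/rV0Pn.
  - exact: (eigen_orthogonal (node_neq _ _ i0)).
  have {}uic : u i = c *: z by apply/rowP => j; rewrite mxE uic.
  have uiM : u i *m M ^+ 2 = node 0 *: u i.
    by rewrite uic -scalemxAl zMM !scalerA mulrC.
  have /eqP := uM i; rewrite uiM -subr_eq0 -scalerBl scaler_eq0.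
  by rewrite (negPf (u_neq0 i)) orbF subr_eq0 eq_sym (negPf (node_neq _ _ i0)).
rewrite (krylov_moment _ eps_sqr); case: ifP => // _; congr (_ * _).
have uMX i e : u i *m (M ^+ 2) ^+ e = node i ^+ e *: u i.
  elim: e => [|e IH]; first by rewrite !expr0 mulmx1 scale1r.
  by rewrite exprS mulmxA uM -scalemxAl IH scalerA exprS.
rewrite del0E mulmx_suml frame_dot_suml; apply: eq_bigr => i _.
rewrite uMX frame_dotZl inord_val frame_dotC frame_dot_suml (bigD1 i) //= big1 ?addr0 //.
by move=> j ji; apply: u_orth.
Qed.

End Spectrum.

(** * The explicit spirals and their frames *)

Lemma is_derive_mx (R : realType) m n (F : R -> 'M[R]_(m, n)) (t : R)
    (dF : 'M[R]_(m, n)) :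
  (forall i j, is_derive t 1 (fun x => F x i j) (dF i j)) -> is_derive t 1 F dF.
Proof.
move=> h; have dh : derivable F t 1 by apply/derivable_mxP => i j; case: (h i j).
split=> //; rewrite derive_mx //; apply/matrixP => i j; rewrite mxE.
by case: (h i j).
Qed.

Lemma is_derive_coord (R : realType) m n (F : R -> 'M[R]_(m, n)) (t : R)
    (dF : 'M[R]_(m, n)) i j :
  is_derive t 1 F dF -> is_derive t 1 (fun x => F x i j) (dF i j).
Proof.
move=> [dh <-]; have dij := (derivable_mxP _ _ _).1 dh i j.
by split=> //; rewrite derive_mx // mxE.
Qed.

Lemma ladder_derive (R : realType) (V : normedModType R) (eps r c : nat -> R)
    (F : nat -> R -> V) (t : R) :
  (forall b, is_derive t 1 (F b) (F b.+1 t)) ->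
  forall i b, is_derive t 1 (fun x => ladder eps r c (F^~ x) i b)
    (ladder eps r c (F^~ t) i b.+1).
Proof.
move=> dF; apply: nat_ind2 => [b|//|i IH0 IH1 b]; first exact: is_derive_cst.
exact: is_deriveZ (is_deriveD (is_deriveZ _ (IH0 b)) (IH1 b.+1)).
Qed.

Lemma sum_pairs (V : nmodType) k (F : nat -> V) :
  \sum_(j < k.*2.+1) F j = \sum_(i < k) (F i.*2 + F i.*2.+1) + F k.*2.
Proof.
elim: k => [|k IH]; first by rewrite big_ord0 big_ord_recr big_ord0.
by rewrite doubleS 2!big_ord_recr /= IH big_ord_recr /= !addrA.
Qed.

Lemma ldotE (R : realType) n (x y : 'cV[R]_n.+1) :
  ldot x y = \sum_j (if j == 0 then -1 else 1) * (x j 0 * y j 0).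
Proof.
rewrite /ldot /lorentz_mx mul_mx_diag mxE.
by apply: eq_bigr => j _; rewrite !mxE mulrAC mulrC.
Qed.

Lemma ldotC (R : realType) n (x y : 'cV[R]_n.+1) : ldot x y = ldot y x.
Proof. by rewrite !ldotE; apply: eq_bigr => j _; rewrite (mulrC (x j 0)). Qed.

Lemma ldotDl (R : realType) n (x y z : 'cV[R]_n.+1) :
  ldot (x + y) z = ldot x z + ldot y z.
Proof. by rewrite /ldot linearD /= !mulmxDl mxE. Qed.

Lemma ldotZl (R : realType) n a (x z : 'cV[R]_n.+1) :
  ldot (a *: x) z = a * ldot x z.
Proof. by rewrite /ldot linearZ /= -!scalemxAl mxE. Qed.

Section SpiralDerivatives.
Variables (R : realType) (k : nat) (kt lam a : nat -> R) (x0 x1 : R -> R).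
Hypotheses (k_ge1 : (1 <= k)%N).
Hypotheses (dx0 : forall s : R, is_derive s 1 x0 (lam 1%N * x1 s))
  (dx1 : forall s : R, is_derive s 1 x1 (lam 1%N * x0 s)).
Local Notation node := (spiral_node k lam).
Local Notation theta := (spiral_theta kt lam).
Local Notation b := (spiral_b kt lam).

Definition spiral_coord (j : nat) (s : R) : R :=
  if j == 0%N then x0 s
  else if j == 1%N then x1 s
  else if j == k.*2 then a k.+1
  else let i := j./2.+1 in
    if odd j then - (a i / b i * cos (theta i s)) else a i / b i * sin (theta i s).
Local Notation X := spiral_coord.

Definition spiral_dcoord (j : nat) (s : R) : R :=
  if j == 0%N then lam 1%N * x1 s
  else if j == 1%N then lam 1%N * x0 s
  else if j == k.*2 then 0
  else let i := j./2.+1 in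
    if odd j then a i / b i * (lam i * sin (theta i s))
    else a i / b i * (lam i * cos (theta i s)).
Local Notation Y := spiral_dcoord.

Lemma is_derive_affine (u v s : R) : is_derive s 1 (fun x => u * x + v) u.
Proof.
apply: (is_derive_eq (is_deriveD (is_deriveZ u (is_derive_id s (1 : R)))
  (is_derive_cst v s (1 : R)))).
by rewrite addr0 [LHS]mulr1.
Qed.

Lemma spiral_theta_derive i (s : R) : (i != 1)%N ->
  is_derive s 1 (theta i) (lam i).
Proof. by move=> /negPf i1; rewrite /spiral_theta i1; apply: is_derive_affine. Qed.

Lemma is_derive_sin_theta i (A s : R) : (i != 1)%N ->
  is_derive s 1 (fun x => A * sin (theta i x)) (A * (lam i * cos (theta i s))).
Proof.
move=> /spiral_theta_derive dth.
apply: (is_derive_eq (is_deriveZ A (is_derive1_comp (is_derive_sin _) (dth s)))).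
by congr (_ * _); rewrite mulrC.
Qed.

Lemma is_derive_cos_theta i (A s : R) : (i != 1)%N ->
  is_derive s 1 (fun x => A * cos (theta i x)) (- (A * (lam i * sin (theta i s)))).
Proof.
move=> /spiral_theta_derive dth.
apply: (is_derive_eq (is_deriveZ A (is_derive1_comp (is_derive_cos _) (dth s)))).
by rewrite -![_ *: _]/(_ * _); ring.
Qed.

Lemma spiral_coord_derive j (s : R) : is_derive s 1 (X j) (Y j s).
Proof.
rewrite /X /Y; case: ifP => j0; first exact: dx0.
case: ifP => [_|j1]; first exact: dx1.
case: ifP => _; first exact: is_derive_cst.
have j2 : (j./2.+1 != 1)%N by lia.
case: ifP => _; last exact: is_derive_sin_theta.
by apply: (is_derive_eq (is_deriveN (is_derive_cos_theta _ s j2))); rewrite opprK.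
Qed.

(** Hyperbolic motion in the first plane, rotation in the others and rest on the axis: each
    coordinate solves the second-order equation of its own node. *)
Lemma spiral_dcoord_derive j (s : R) : (j <= k.*2)%N ->
  is_derive s 1 (Y j) (node j./2 * X j s).
Proof.
move=> le_j; rewrite /X /Y /node; have [->|j0] := eqVneq j 0%N.
  by apply: (is_derive_eq (is_deriveZ _ (dx1 s))); rewrite /= expr2 -mulrA.
have [->|j1] := eqVneq j 1%N.
  by apply: (is_derive_eq (is_deriveZ _ (dx0 s))); rewrite /= expr2 -mulrA.
have [->|jk] := eqVneq j k.*2.
  by rewrite doubleK eqxx gtn_eqF // mul0r; exact: is_derive_cst.
have -> : (j./2 == 0)%N = false by lia.
have -> : (j./2 == k)%N = false by lia.
have j2 : (j./2.+1 != 1)%N by lia.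
case: ifP => _.
  under eq_fun do rewrite mulrA.
  apply: (is_derive_eq (is_derive_sin_theta _ s j2)); ring.
under eq_fun do rewrite mulrA.
apply: (is_derive_eq (is_derive_cos_theta _ s j2)); ring.
Qed.

(* The e-th derivative of exp(- kt_1 s) gamma'(s), gamma being the spiral. *)
Definition spiral_deriv (e : nat) (s : R) : 'cV[R]_(k.*2.+1) :=
  \col_j (node j./2 ^+ e./2 *
    (if odd e then kt 1%N * Y j s + node j./2 * X j s
     else kt 1%N * X j s + Y j s)).

Lemma spiral_deriv_derive e (s : R) :
  is_derive s 1 (spiral_deriv e) (spiral_deriv e.+1 s).
Proof.
apply: is_derive_mx => j i; rewrite !mxE.
have -> : (fun x => spiral_deriv e x j i) = (fun x => node j./2 ^+ e./2 *
    (if odd e then kt 1%N * Y j x + node j./2 * X j x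
     else kt 1%N * X j x + Y j x)) by apply/funext => x; rewrite mxE.
have dX := spiral_coord_derive j s.
have dY : is_derive s 1 (Y j) (node j./2 * X j s).
  by apply: spiral_dcoord_derive; rewrite -ltnS.
rewrite /= uphalf_half; case: (odd e) => /=.
  apply: (is_derive_eq (is_deriveZ _ (is_deriveD (is_deriveZ _ dY) (is_deriveZ _ dX)))).
  by rewrite add1n exprS -![_ *: _]/(_ * _); ring.
by apply: (is_derive_eq (is_deriveZ _ (is_deriveD (is_deriveZ _ dX) dY))).
Qed.

Lemma spiral_derive (s : R) : is_derive s 1 (spiral k kt lam a x0 x1)
  (expR (kt 1%N * s) *: spiral_deriv 0 s).
Proof.
apply: is_derive_mx => j i; rewrite !mxE expr0 mul1r.
have -> : (fun x => spiral k kt lam a x0 x1 x j i) =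
    (fun x => expR (kt 1%N * x) * X j x) by apply/funext => x; rewrite !mxE.
have dE : is_derive s 1 (fun x => kt 1%N * x) (kt 1%N).
  by apply: (is_derive_eq (is_deriveZ _ (is_derive_id s (1 : R)))); rewrite [LHS]mulr1.
apply: (is_derive_eq (is_deriveM (is_derive1_comp (is_derive_expR _) dE)
  (spiral_coord_derive j s))).
by rewrite -![_ *: _]/(_ * _) /=; ring.
Qed.

Lemma derive1_spiral (s : R) : derive1 (spiral k kt lam a x0 x1) s =
  expR (kt 1%N * s) *: spiral_deriv 0 s.
Proof. by rewrite derive1E; case: (spiral_derive s). Qed.

Section Weighted.
Variable w : nat -> R.
Hypotheses (kt1_neq0 : kt 1%N != 0)
  (x_weight : forall s : R,
    (kt 1%N ^+ 2 - lam 1%N ^+ 2) * (x1 s ^+ 2 - x0 s ^+ 2) = w 0%N)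
  (a_weight : forall i, (0 < i < k)%N -> a i.+1 ^+ 2 = w i)
  (a_weight_last : kt 1%N ^+ 2 * a k.+1 ^+ 2 = w k).

Lemma spiral_b_sqr i : (1 < i)%N -> b i ^+ 2 = lam i ^+ 2 + kt 1%N ^+ 2.
Proof. by move=> i1; rewrite /spiral_b gtn_eqF // sqr_sqrtr // addr_ge0 ?sqr_ge0. Qed.

Definition block (F : 'cV[R]_(k.*2.+1)) (j : nat) := F (inord j) 0.

Lemma block_spiral_deriv e (s : R) j : (j <= k.*2)%N ->
  block (spiral_deriv e s) j = node j./2 ^+ e./2 *
    (if odd e then kt 1%N * Y j s + node j./2 * X j s
     else kt 1%N * X j s + Y j s).
Proof. by move=> le_j; rewrite /block mxE inordK. Qed.

Definition spiral_moment (e f i : nat) : R :=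
  if odd (e + f) then 0 else (-1) ^+ f * node i ^+ (e + f)./2 * w i.

(** For e = f = 0 the sum is (kt_1^2 - lam_1^2) (x1^2 - x0^2). Each further derivative exchanges the
    two components and multiplies them by lam_1; the exchange reverses the sign of the form, whence
    (-1)^f and the vanishing for e + f odd. *)
Lemma spiral_block0 e f (s : R) :
  - (block (spiral_deriv e s) 0 * block (spiral_deriv f s) 0)
  + block (spiral_deriv e s) 1 * block (spiral_deriv f s) 1 = spiral_moment e f 0.
Proof.
have k2 : (1 <= k.*2)%N by lia.
rewrite !block_spiral_deriv // /spiral_moment -(x_weight s) /= halfD oddD.
rewrite /X /Y /node !eqxx !exprD -(signr_odd _ f).
by case: (odd e); case: (odd f); rewrite /= ?addbF ?expr0 ?expr1; ring.
Qed.

(** For e = f = 0 the sum is (a / b)^2 (lam^2 + kt_1^2), and b is the number that turns this into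
    a^2. Each further derivative is a quarter turn times lam. *)
Lemma spiral_block e f i (s : R) : (0 < i < k)%N ->
  block (spiral_deriv e s) i.*2 * block (spiral_deriv f s) i.*2
  + block (spiral_deriv e s) i.*2.+1 * block (spiral_deriv f s) i.*2.+1 =
  spiral_moment e f i.
Proof.
move=> Hi; have i2 : (i.*2.+1 <= k.*2)%N by lia.
rewrite !block_spiral_deriv ?(ltnW i2) // /spiral_moment -a_weight //.
(* With b^2 and cos^2 + sin^2 = 1 written out, what remains is a polynomial identity. *)
have -> : a i.+1 ^+ 2 = (a i.+1 / b i.+1) ^+ 2 * (lam i.+1 ^+ 2 + kt 1%N ^+ 2)
    * (cos (theta i.+1 s) ^+ 2 + sin (theta i.+1 s) ^+ 2).
  rewrite cos2Dsin2 mulr1 -spiral_b_sqr -?exprMn ?divfK //; last lia.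
  rewrite -sqrf_eq0 spiral_b_sqr; last lia.
  by rewrite paddr_eq0 ?sqr_ge0 // !sqrf_eq0 (negPf kt1_neq0) andbF.
rewrite halfD oddD /= uphalf_double doubleK /X /Y /node /=.
rewrite uphalf_double doubleK odd_double /=.
have -> : (i.*2 == 0)%N = false by lia.
have -> : (i.*2 == 1)%N = false by lia.
have -> : (i.*2.+1 == 1)%N = false by lia.
have -> : (i.*2 == k.*2)%N = false by lia.
have -> : (i.*2.+1 == k.*2)%N = false by lia.
have -> : (i == 0)%N = false by lia.
have -> : (i == k)%N = false by lia.
rewrite !exprD -(signr_odd _ f).
by case: (odd e); case: (odd f); rewrite /= ?addbF ?expr0 ?expr1; ring.
Qed.

Lemma spiral_block_last e f (s : R) :
  block (spiral_deriv e s) k.*2 * block (spiral_deriv f s) k.*2 =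
  spiral_moment e f k.
Proof.
rewrite !block_spiral_deriv // /spiral_moment -a_weight_last doubleK.
rewrite halfD oddD /X /Y /node eqxx.
have -> : (k == 0)%N = false by lia.
have -> : (k.*2 == 0)%N = false by lia.
have -> : (k.*2 == 1)%N = false by lia.
rewrite !exprD eqxx -(signr_odd _ f).
by case: (odd e); case: (odd f); rewrite /= ?addbF ?expr0 ?expr1; ring.
Qed.

(** The planes and the axis of the spiral play the part of the eigenspaces, and the result is the
    moment formula of [spectral_weights]. *)
Lemma ldot_spiral_deriv e f (s : R) :
  ldot (spiral_deriv e s) (spiral_deriv f s) =
  if odd (e + f) then 0
  else (-1) ^+ f * \sum_(i < k.+1) node i ^+ (e + f)./2 * w i.
Proof.
rewrite ldotE.
pose G (j : nat) := (if j == 0%N then -1 else 1) *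
  (block (spiral_deriv e s) j * block (spiral_deriv f s) j).
have -> : \sum_(j < k.*2.+1) (if j == 0 then -1 else 1) *
  (spiral_deriv e s j 0 * spiral_deriv f s j 0) = \sum_(j < k.*2.+1) G j.
  by apply: eq_bigr => j _; rewrite /G /block inord_val.
have G_gt0 j : (0 < j)%N ->
    G j = block (spiral_deriv e s) j * block (spiral_deriv f s) j.
  by move=> j0; rewrite /G gtn_eqF // mul1r.
have -> : (if odd (e + f) then 0
    else (-1) ^+ f * \sum_(i < k.+1) node i ^+ (e + f)./2 * w i) =
  \sum_(i < k.+1) spiral_moment e f i.
  rewrite /spiral_moment; case: ifP => _; first by rewrite big1.
  by rewrite mulr_sumr; apply: eq_bigr => i _; rewrite mulrA.
rewrite sum_pairs G_gt0 ?double_gt0 // spiral_block_last big_ord_recr /=.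
congr (_ + _); apply: eq_bigr => -[[|i] Hi] _ /=.
  by rewrite /G /= mulN1r mul1r spiral_block0.
by rewrite !G_gt0 // spiral_block.
Qed.

End Weighted.

Section Frame.
Variables (eps : nat -> R) (m : nat).
Hypothesis eps_m : forall l, (1 <= l <= k.*2.+1)%N -> eps l = if l == m then -1 else 1.
Hypothesis m_le2 : (m <= 2)%N.
Local Notation r := (curvature_ratio kt).
Local Notation c := (fun i => (eps i.+1 * r i)^-1).

Definition spiral_ladder (i e : nat) (s : R) :=
  ladder eps r c (spiral_deriv^~ s) i e.

Lemma spiral_ladder_derive i e (s : R) :
  is_derive s 1 (spiral_ladder i e) (spiral_ladder i e.+1 s).
Proof. by apply: ladder_derive => f; apply: spiral_deriv_derive. Qed.

(** Differentiating a vector of the frame amounts to shifting the second index of the ladder. The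
    factor [(kt j)^-1] agrees with the one of the ladder because eps_(j+1) = 1 for j >= 2, by
    [m_le2]. *)
Lemma spiral_frameE i : (i <= k.*2.+1)%N ->
  spiral_frame m kt (spiral k kt lam a x0 x1) i = spiral_ladder i 0.
Proof.
elim/nat_ind2: i => [//|_|i IH0 IH1 Hi]; apply/funext => s.
  by rewrite /= derive1_spiral scalerA -expRD mulNr addNr expR0 scale1r.
have dE : derive1 (spiral_frame m kt (spiral k kt lam a x0 x1) i.+1) s
    = spiral_ladder i.+1 1 s.
  by rewrite IH1 1?ltnW // derive1E; case: (spiral_ladder_derive i.+1 0 s).
have -> : spiral_ladder i.+2 0 s = c i.+1 *: ((eps i * r i) *: spiral_ladder i 0 s
  + spiral_ladder i.+1 1 s) by [].
rewrite -dE; case: i {IH1} IH0 Hi dE => [|i] IH0 Hi _.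
  rewrite /spiral_ladder /= scaler0 add0r /curvature_ratio /= mulr1 eps_m //.
  by case: ifP; rewrite ?invrN invr1.
rewrite (eps_m (l := i.+3)) // gtn_eqF ?(leq_ltn_trans m_le2) // mul1r.
rewrite (eps_m (l := i.+1)); last lia.
by rewrite -IH0; last lia.
Qed.

Lemma spiral_ladder_gram w i j e f (s : R) : kt 1%N != 0 ->
  (forall s : R,
    (kt 1%N ^+ 2 - lam 1%N ^+ 2) * (x1 s ^+ 2 - x0 s ^+ 2) = w 0%N) ->
  (forall i, (0 < i < k)%N -> a i.+1 ^+ 2 = w i) ->
  kt 1%N ^+ 2 * a k.+1 ^+ 2 = w k ->
  (forall e f, frame_dot eps (krylov k.*2 eps kt e) (krylov k.*2 eps kt f) =
    if odd (e + f) then 0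
    else (-1) ^+ f * \sum_(i < k.+1) node i ^+ (e + f)./2 * w i) ->
  ldot (spiral_ladder i e s) (spiral_ladder j f s) =
  frame_dot eps (ladder eps r c (krylov k.*2 eps kt) i e)
                (ladder eps r c (krylov k.*2 eps kt) j f).
Proof.
move=> kt1_neq0 x_weight a_weight a_weight_last krylov_moments.
apply: ladder_gram.
- exact: ldotDl.
- exact: ldotZl.
- exact: ldotC.
- exact: frame_dotDl.
- exact: frame_dotZl.
- exact: frame_dotC.
- by move=> e' f'; rewrite (ldot_spiral_deriv (w := w)) // krylov_moments.
Qed.

End Frame.
End SpiralDerivatives.

(** * Congruence of curves with the same Frenet matrix *)

Lemma zero_derive_constant (R : realType) (I : set R) m n (F : R -> 'M[R]_(m, n)) :
  is_interval I -> (forall s : R, I s -> is_derive s 1 F (0 : 'M[R]_(m, n))) ->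
  forall s t, I s -> I t -> F s = F t.
Proof.
move=> itvI dF s t Is It; apply/matrixP => i j.
wlog le_st : s t Is It / s <= t.
  by move=> wl; case: (leP s t) => [|/ltW] h; [apply: wl|apply/esym/wl].
have I_st x : x \in `[s, t] -> I x.
  by rewrite in_itv => h; apply: (itvI s t).
pose f x := F x i j.
have df x : x \in `[s, t] -> is_derive x 1 f 0.
  move=> /I_st Ix; have := is_derive_coord i j (dF x Ix); by rewrite mxE.
have df' x : x \in `]s, t[%R -> is_derive x 1 f 0.
  by move=> /subset_itv_oo_cc; exact: df.
have cf : {within `[s, t], continuous f}.
  by apply: derivable_within_continuous => x /df [].
have [x _] := MVT_segment le_st df' cf.
by rewrite mul0r => /eqP; rewrite subr_eq0 eq_sym => /eqP.
Qed.

Lemma is_derive_mulmx (R : realType) m n q (P : R -> 'M[R]_(m, n))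
    (Q : R -> 'M[R]_(n, q)) (t : R) (dP : 'M[R]_(m, n)) (dQ : 'M[R]_(n, q)) :
  is_derive t 1 P dP -> is_derive t 1 Q dQ ->
  is_derive t 1 (fun x => P x *m Q x) (dP *m Q t + P t *m dQ).
Proof.
move=> hP hQ; apply: is_derive_mx => i j.
have -> : (fun x => (P x *m Q x) i j) = \sum_(l < n) (fun x => P x i l * Q x l j).
  by apply/funext => x; rewrite mxE fct_sumE.
rewrite !mxE -big_split; apply: is_derive_sum => l.
apply: (is_derive_eq (is_deriveM (is_derive_coord i l hP) (is_derive_coord l j hQ))).
by rewrite -![_ *: _]/(_ * _) /=; ring.
Qed.

Lemma is_derive_mx_comp (R : realType) m n (F : R -> 'M[R]_(m, n)) (g : R -> R)
    (t dg : R) (dF : 'M[R]_(m, n)) :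
  is_derive (g t) 1 F dF -> is_derive t 1 g dg ->
  is_derive t 1 (fun x => F (g x)) (dg *: dF).
Proof.
move=> hF hg; apply: is_derive_mx => i j; rewrite mxE mulrC.
exact: (is_derive1_comp (is_derive_coord i j hF) hg).
Qed.

Lemma is_derive_trmx (R : realType) m n (F : R -> 'M[R]_(m, n)) (t : R)
    (dF : 'M[R]_(m, n)) :
  is_derive t 1 F dF -> is_derive t 1 (fun x => (F x)^T) dF^T.
Proof.
move=> hF; apply: is_derive_mx => i j; rewrite mxE.
under eq_fun do rewrite mxE; exact: is_derive_coord.
Qed.

Definition frame_mx (R : realType) n (v : nat -> 'cV[R]_n.+1) : 'M[R]_n.+1 :=
  \matrix_(i, j) v i.+1 j 0.

Lemma frenet_mx_mul_frame (R : realType) n (eps kt : nat -> R)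
    (v : nat -> 'cV[R]_n.+1) (i j : 'I_n.+1) :
  (frenet_mx n eps kt *m frame_mx v) i j =
  (if (i < n)%N then (eps i.+2 * curvature_ratio kt i.+1) *: v i.+2 else 0) j 0
  - (if (0 < i)%N then (eps i * curvature_ratio kt i) *: v i else 0) j 0.
Proof.
have unitE l : (l <= n)%N -> frame_unit R n l *m frame_mx v = (v l.+1)^T.
  move=> le_l; apply/rowP => q; rewrite mxE (bigD1 (inord l)) //= big1 ?addr0.
    by rewrite !mxE inordK // eqxx mul1r.
  move=> p; rewrite -val_eqE /= inordK // => /negPf pl.
  by rewrite mxE pl mul0r.
have -> : (frenet_mx n eps kt *m frame_mx v) i j =
    (frame_unit R n i *m frenet_mx n eps kt *m frame_mx v) 0 j.
  have -> : frame_unit R n i = delta_mx 0 i.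
    by apply/rowP => q; rewrite !mxE eqxx -val_eqE.
  by rewrite -mulmxA -rowE [in RHS]mxE.
rewrite frame_unit_mul -1?ltnS // mulmxBl -!scalemxAl.
rewrite mxE [in X in _ + X]mxE; congr (_ - _).
  rewrite mxE; case: ifP => [lt_in|ge_in]; first by rewrite unitE // !mxE.
  have -> : frame_unit R n i.+1 = 0.
    apply/rowP => q; rewrite !mxE; have := ltn_ord q.
    by case: eqP => // ->; lia.
  by rewrite mul0mx !mxE mulr0.
case: i => -[|i] /= Hi; first by rewrite scale0r !mxE.
by rewrite unitE; [rewrite !mxE|exact: ltnW].
Qed.

Section Congruence.
Variables (R : realType) (k : nat) (I : set R)
  (alpha : R -> 'cV[R]_(k.*2.+1)) (e : nat -> R -> 'cV[R]_(k.*2.+1))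
  (eps : nat -> R) (kappa : nat -> R -> R) (sigma : R -> R) (kt : nat -> R).
Local Notation n := k.*2.
Hypotheses (k_ge1 : (1 <= k)%N) (I_interval : is_interval I) (I_neq0 : I !=set0)
  (alpha_frenet : frenet_curve I alpha e eps kappa)
  (sigma_spherical : arc_length_parameter I (e 1%N) sigma)
  (kt_shape : forall i s, (1 <= i <= n)%N -> I s ->
     shape_curvature kappa sigma i s = kt i).
Local Notation M := (frenet_mx n eps kt).
Local Notation L := (lorentz_mx R n).
Local Notation D := (diag_mx (\row_(j < n.+1) eps j.+1)).

Lemma frenet_eps_sqr i : (1 <= i <= n.+1)%N -> eps i * eps i = 1.
Proof.
by move=> /(frenet_eps alpha_frenet)[] ->; rewrite ?mulr1 // mulrNN mulr1.
Qed.

Lemma kappa1_gt0 s : I s -> 0 < kappa 1%N s.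
Proof. by move=> Is; apply: (frenet_curvature_gt0 alpha_frenet) => //; lia. Qed.

Lemma spherical_derive (s : R) : I s -> is_derive s 1 sigma (kappa 1%N s).
Proof.
move=> Is; have := sigma_spherical Is.
have -> : derive1 (e 1%N) s = (eps 2%N * kappa 1%N s) *: e 2%N s.
  by rewrite derive1E; case: (frenet_first alpha_frenet Is).
rewrite ldotZl ldotC ldotZl (frenet_orthonormal alpha_frenet) //; try lia.
rewrite eqxx (_ : _ * _ = eps 2%N * eps 2%N * eps 2%N * kappa 1%N s ^+ 2); last by ring.
rewrite frenet_eps_sqr ?mul1r; last lia.
rewrite normrM normrX.
have -> : `|eps 2%N| = 1.
  by have [|->|->] := frenet_eps alpha_frenet (i := 2%N); rewrite ?normrN ?normr1 //; lia.
by rewrite mul1r sqrtr_sqr normr_id gtr0_norm // kappa1_gt0.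
Qed.

Lemma kappaE i s : (1 <= i <= n)%N -> I s ->
  kappa i s = kappa 1%N s * curvature_ratio kt i.
Proof.
move=> Hi Is; rewrite /curvature_ratio; have [->|i1] := eqVneq i 1%N.
  by rewrite mulr1.
rewrite -(kt_shape Hi Is) /shape_curvature (negPf i1) mulrC divfK //.
by rewrite gt_eqF // kappa1_gt0.
Qed.

Lemma kappa1_derive (s : R) : I s ->
  is_derive s 1 (kappa 1%N) (- (kt 1%N * kappa 1%N s ^+ 2)).
Proof.
move=> Is; have dk := frenet_curvature1_derivable alpha_frenet Is.
apply: (is_derive_eq (derivableP dk)); rewrite -derive1E.
have n1 : (1 <= 1 <= n)%N by lia.
rewrite -(kt_shape n1 Is) /shape_curvature eqxx.
have -> : derive1 sigma s = kappa 1%N s.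
  by rewrite derive1E; case: (spherical_derive Is).
have k0 : kappa 1%N s != 0 by rewrite gt_eqF // kappa1_gt0.
by field.
Qed.

Lemma frame_derive (s : R) : I s ->
  is_derive s 1 (fun x => frame_mx (e^~ x)) (kappa 1%N s *: (M *m frame_mx (e^~ s))).
Proof.
move=> Is; apply: is_derive_mx => i j; rewrite mxE frenet_mx_mul_frame.
have -> : (fun x => frame_mx (e^~ x) i j) = (fun x => e i.+1 x j 0).
  by apply/funext => x; rewrite mxE.
have Hi := ltn_ord i; rewrite ltnS in Hi.
pose A := if (i < n)%N then (eps i.+2 * curvature_ratio kt i.+1) *: e i.+2 s else 0.
pose B := if (0 < i)%N then (eps i * curvature_ratio kt i) *: e i s else 0.
suff h : is_derive s 1 (e i.+1) (kappa 1%N s *: (A - B)).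
  by apply: (is_derive_eq (is_derive_coord j 0 h)); rewrite !mxE.
rewrite {}/A {}/B; have [i0|i0] := posnP i.
  rewrite i0 double_gt0 k_ge1 subr0.
  apply: (is_derive_eq (frenet_first alpha_frenet Is)).
  by rewrite scalerA; congr (_ *: _); rewrite /curvature_ratio /=; ring.
have [lt_in|ge_in] := ltnP i n.
  have Hi1 : (2 <= i.+1 <= n)%N by lia.
  apply: (is_derive_eq (frenet_middle alpha_frenet Is Hi1)).
  rewrite /= (kappaE (i := i)) ?(kappaE (i := i.+1)) //; try lia.
  by rewrite scalerBr !scalerA addrC -scaleNr; congr (_ *: _ + _ *: _); ring.
have -> : nat_of_ord i = n by lia.
apply: (is_derive_eq (frenet_last alpha_frenet Is)).
rewrite (kappaE (i := n)) //; last lia.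
by rewrite sub0r scalerN -scaleNr scalerA; congr (_ *: _); ring.
Qed.

Lemma frame_mx_gram (v : nat -> 'cV[R]_n.+1) :
  (forall i j, (1 <= i <= n.+1)%N -> (1 <= j <= n.+1)%N ->
    ldot (v i) (v j) = if i == j then eps i else 0) ->
  frame_mx v *m L *m (frame_mx v)^T = D.
Proof.
move=> orth; apply/matrixP => i j; rewrite !mxE.
transitivity (ldot (v i.+1) (v j.+1)).
  rewrite /ldot mxE; apply: eq_bigr => l _; rewrite !mxE; congr (_ * _).
  by apply: eq_bigr => q _; rewrite !mxE.
have Hi := ltn_ord i; have Hj := ltn_ord j.
rewrite orth //= eqSS val_eqE; case: eqVneq => [->|_]; by rewrite ?mulr1n ?mulr0n.
Qed.

Lemma lorentz_mxK : L *m L = 1%:M.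
Proof.
rewrite /lorentz_mx mulmx_diag -diag_const_mx; congr diag_mx.
apply/rowP => j; rewrite !mxE; case: ifP => _; by rewrite ?mulrNN mulr1.
Qed.

Lemma signs_mxK : D *m D = 1%:M.
Proof.
rewrite mulmx_diag -diag_const_mx; congr diag_mx.
by apply/rowP => j; rewrite !mxE frenet_eps_sqr // ltn_ord.
Qed.

(** Antisymmetry of M D is [frenet_mx_skew]; conjugating by the involution D yields that of D M. *)
Lemma signs_frenet_mx : M^T *m D = - (D *m M).
Proof.
have MTD i j : (M^T *m D) i j = eps j.+1 * M j i.
  by rewrite mul_mx_diag mxE mxE [X in _ * X]mxE mulrC.
have DM i j : (D *m M) i j = eps i.+1 * M i j.
  by rewrite mul_diag_mx mxE [X in X * _]mxE.
apply/matrixP => i j; rewrite MTD [in RHS]mxE DM.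
have ei : eps i.+1 * eps i.+1 = 1 by apply: frenet_eps_sqr; rewrite ltn_ord.
have ej : eps j.+1 * eps j.+1 = 1 by apply: frenet_eps_sqr; rewrite ltn_ord.
have h := frenet_mx_skew kt frenet_eps_sqr i j.
rewrite -[LHS]mul1r -ei -[in RHS](mul1r (eps i.+1)) -ej.
rewrite (_ : _ * _ = eps i.+1 * eps j.+1 * (eps i.+1 * M j i)); last by ring.
by rewrite -[eps i.+1 * M j i]opprK -h; ring.
Qed.

Section Model.
Variables (gamma : R -> 'cV[R]_n.+1) (v : nat -> R -> 'cV[R]_n.+1).
Hypotheses
  (v_gram : forall t i j, (1 <= i <= n.+1)%N -> (1 <= j <= n.+1)%N ->
    ldot (v i t) (v j t) = if i == j then eps i else 0)
  (v_derive : forall t : R,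
    is_derive t 1 (fun x => frame_mx (v^~ x)) (M *m frame_mx (v^~ t)))
  (gamma_derive : forall t : R, is_derive t 1 gamma (expR (kt 1%N * t) *: v 1%N t)).
Local Notation F t := (frame_mx (v^~ t)).
Local Notation G s := (frame_mx (e^~ s)).

(* The map sending the frame [e] at [s] to the model frame [v] at [sigma s]. *)
Definition frame_transfer (s : R) := (F (sigma s))^T *m D *m (G s *m L).

(** Both frames, as functions of s, solve the same linear equation with matrix kappa_1 M, so the
    derivative contains the factor M^T D + D M = 0. *)
Lemma frame_transfer_constant s t : I s -> I t ->
  frame_transfer s = frame_transfer t.
Proof.
apply: zero_derive_constant => // x Ix.
have dF := is_derive_mx_comp (v_derive (sigma x)) (spherical_derive Ix).
have dFD := is_derive_mulmx (is_derive_trmx dF) (is_derive_cst D x (1 : R)).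
have dGL := is_derive_mulmx (frame_derive Ix) (is_derive_cst L x (1 : R)).
apply: (is_derive_eq (is_derive_mulmx dFD dGL)).
rewrite !mulmx0 !addr0 linearZ /= trmx_mul -!scalemxAl -!scalemxAr.
rewrite -(mulmxA _ M^T) signs_frenet_mx mulmxN mulNmx !mulmxA.
by rewrite scalerN addNr.
Qed.

Lemma gram_inverse A : A *m L *m A^T = D -> A^T *m D *m A = L.
Proof.
move=> AL; have AD : A *m (L *m A^T *m D) = 1%:M by rewrite !mulmxA AL signs_mxK.
have /(congr1 (mulmx L)) := mulmx1C AD.
by rewrite mulmx1 !mulmxA lorentz_mxK mul1mx.
Qed.

Lemma frame_transfer_pseudo_orthogonal s : I s ->
  (frame_transfer s)^T *m L *m frame_transfer s = L.
Proof.
move=> Is; rewrite /frame_transfer.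
have FL := frame_mx_gram (v_gram (sigma s)).
have GL := frame_mx_gram
  (fun i j => frenet_orthonormal alpha_frenet (i := i) (j := j) Is).
rewrite !trmx_mul trmxK !tr_diag_mx -!mulmxA.
rewrite (mulmxA (F _) L) (mulmxA (F _ *m L)) FL !mulmxA.
rewrite -(mulmxA _ D D) signs_mxK mulmx1.
rewrite -(mulmxA L) -(mulmxA L) gram_inverse // lorentz_mxK mul1mx //.
Qed.

(** By the Gram relation D G L is the inverse of G^T, so the transfer is F^T (G^T)^-1; its action on
    e_1 is read off in the first column. *)
Lemma frame_transfer_tangent s : I s ->
  frame_transfer s *m e 1%N s = v 1%N (sigma s).
Proof.
move=> Is.
have GL := frame_mx_gram
  (fun i j => frenet_orthonormal alpha_frenet (i := i) (j := j) Is).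
have firstE (w : nat -> 'cV[R]_n.+1) : w 1%N = col 0 (frame_mx w)^T.
  by apply/colP => i; rewrite !mxE.
rewrite (firstE (e^~ s)) (firstE (v^~ (sigma s))) !colE mulmxA /frame_transfer.
by congr (_ *m _); rewrite -!mulmxA (mulmxA (G s)) GL signs_mxK mulmx1.
Qed.

(** This is the ratio between the speeds of [gamma] at [sigma s] and of [alpha] at [s], hence the
    ratio of the similarity. It is constant because kappa_1' = - kt_1 kappa_1^2 and sigma' =
    kappa_1. *)
Lemma conformal_factor_constant s t : I s -> I t ->
  kappa 1%N s * expR (kt 1%N * sigma s) = kappa 1%N t * expR (kt 1%N * sigma t).
Proof.
(* A 1 x 1 matrix, so that [zero_derive_constant] applies. *)
pose f (x : R) : 'M[R]_1 := (kappa 1%N x * expR (kt 1%N * sigma x))%:M.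
move=> Is It; suff : f s = f t.
  by move=> /(congr1 (fun A : 'M[R]_1 => A 0 0)); rewrite !mxE !mulr1n.
apply: (zero_derive_constant I_interval) Is It => x Ix.
apply: is_derive_mx => i j; rewrite mxE !ord1.
have -> : (fun y => f y 0 0) =
    (fun y => kappa 1%N y * expR (kt 1%N * sigma y)).
  by apply/funext => y; rewrite !mxE mulr1n.
have dE : is_derive x 1 (fun y => expR (kt 1%N * sigma y))
    (expR (kt 1%N * sigma x) * (kt 1%N * kappa 1%N x)).
  exact: (is_derive1_comp (is_derive_expR _) (is_deriveZ _ (spherical_derive Ix))).
apply: (is_derive_eq (is_deriveM (kappa1_derive Ix) dE)).
by rewrite -![_ *: _]/(_ * _) /=; ring.
Qed.

(** The transfer [A] scaled by [c] matches the velocities, and the remaining difference [h] is the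
    translation. If [A] has determinant -1, negating both [c] and [A] leaves the map unchanged and,
    the dimension being odd, makes the determinant 1. *)
Lemma congruent_model : exists f : psim R n, forall s, I s ->
  psim_act f (alpha s) = gamma (sigma s).
Proof.
have [s0 Is0] := I_neq0.
pose A := frame_transfer s0.
pose c := kappa 1%N s0 * expR (kt 1%N * sigma s0).
have c_gt0 : 0 < c by rewrite mulr_gt0 ?expR_gt0 ?kappa1_gt0.
have AL : A^T *m L *m A = L by apply: frame_transfer_pseudo_orthogonal.
pose h s := gamma (sigma s) - c *: (A *m alpha s).
have h_cst s : I s -> h s = h s0.
  move=> Is; apply: (zero_derive_constant I_interval) (Is) (Is0) => x Ix.
  have dg := is_derive_mx_comp (gamma_derive (sigma x)) (spherical_derive Ix).
  have da := is_derive_mulmx (is_derive_cst A x (1 : R)) (frenet_tangent alpha_frenet Ix).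
  apply: (is_derive_eq (is_deriveB dg (is_deriveZ c da))).
  rewrite mul0mx add0r /= /A (frame_transfer_constant Is0 Ix) frame_transfer_tangent //.
  by rewrite scalerA /c (conformal_factor_constant Is0 Ix) subrr.
have detA : \det A = 1 \/ \det A = -1.
  move: (A) AL => B BL; have : \det B ^+ 2 == 1.
    have := congr1 determinant BL; rewrite !det_mulmx det_tr => dAL.
    have L0 : \det L != 0.
      have := congr1 determinant lorentz_mxK; rewrite det_mulmx det1.
      by apply: contra_eq_neq => ->; rewrite mulr0 eq_sym oner_neq0.
    by apply/eqP/(mulIf L0); rewrite mul1r -[RHS]dAL expr2 mulrAC.
  by rewrite sqrf_eq1 => /orP[] /eqP; [left|right].
have [s1|s1] := detA.
  have c0 : c != 0 by rewrite gt_eqF.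
  exists (Psim (h s0) c0 AL s1) => s Is; rewrite /psim_act /= -(h_cst s Is) /h.
  by rewrite addrC subrK.
have c0 : - c != 0 by rewrite oppr_eq0 gt_eqF.
have ANL : (- A)^T *m L *m (- A) = L.
  by rewrite [(- A)^T]linearN /= !mulNmx mulmxN opprK.
have s1' : \det (- A) = 1.
  rewrite -scaleN1r detZ s1 -signr_odd /= odd_double expr1.
  by rewrite mulrNN mulr1.
exists (Psim (h s0) c0 ANL s1') => s Is; rewrite /psim_act /= -(h_cst s Is) /h.
by rewrite mulNmx scalerN scaleNr opprK addrC subrK.
Qed.

End Model.
End Congruence.

(** * Amplitudes and realization *)

Lemma frame_dot_krylov_ladder (R : realType) n (eps kt : nat -> R) i j :
  (forall l, (1 <= l <= n.+1)%N -> eps l * eps l = 1) ->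
  (forall l, (1 <= l <= n)%N -> kt l != 0) ->
  (1 <= i <= n.+1)%N -> (1 <= j <= n.+1)%N ->
  let c l := (eps l.+1 * curvature_ratio kt l)^-1 in
  frame_dot eps (ladder eps (curvature_ratio kt) c (krylov n eps kt) i 0)
    (ladder eps (curvature_ratio kt) c (krylov n eps kt) j 0) =
  if i == j then eps i else 0.
Proof.
case: i j => [//|i] [//|j] eps_sqr kt_neq0; rewrite !ltnS => Hi Hj c.
rewrite !ladder_krylov // expr0 !mulmx1.
have := frame_dot_unit eps (Ordinal (Hi : (i < n.+1)%N)) (frame_unit R n j).
by rewrite /= mxE eqSS /= => ->; case: eqP => _; rewrite ?mulr1 ?mulr0.
Qed.

(* Every entry equal in absolute value to an earlier one gets a minus sign. *)
Lemma choose_signs (R : realType) m (c : nat -> R) :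
  (forall i, (1 <= i <= m)%N -> 0 < c i) ->
  exists a : nat -> R, (forall i, (1 <= i <= m)%N -> `|a i| = c i) /\
    different_up_to_triples m a.
Proof.
move=> c_gt0; pose rep i := [exists j : 'I_i, (0 < j)%N && (c j == c i)].
exists (fun i => if rep i then - c i else c i).
have absE i : (1 <= i <= m)%N -> `|if rep i then - c i else c i| = c i.
  by move=> Hi; case: (rep i); rewrite ?normrN gtr0_norm ?c_gt0.
split=> // i j Hi Hj ij aij.
have cij : c i = c j by rewrite -(absE i Hi) aij absE.
wlog lt_ij : i j Hi Hj ij aij cij / (i < j)%N.
  move=> wl; case: (ltngtP i j) => [lt_ij|lt_ji|//]; first exact: (wl i j).
  have [l [Hl li lj al]] := wl j i Hj Hi (nesym ij) (esym aij) (esym cij) lt_ji.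
  by exists l; split=> //; rewrite al !absE.
(* The later index [j] is a repetition, so its value is negative. Equality forces [a i] to be
   negative too, so [i] repeats a still earlier index, which is the third one wanted. *)
have rep_j : rep j.
  by apply/existsP; exists (Ordinal lt_ij); rewrite /= cij eqxx andbT; lia.
have rep_i : rep i.
  apply: contraT => /negPf rep_i; move: aij; rewrite rep_j rep_i -cij => /eqP.
  by rewrite -addr_eq0 -mulr2n mulrn_eq0 /= gt_eqF // c_gt0.
have /existsP[l /andP[l0 /eqP cl]] := rep_i; have Hl := ltn_ord l.
exists l; split; [lia|lia|lia|].
by rewrite !absE //; lia.
Qed.

Lemma coshR_sinhR_sqr (R : realType) (x : R) : coshR x ^+ 2 - sinhR x ^+ 2 = 1.
Proof.
by rewrite /coshR /sinhR -[RHS](expRxMexpNx_1 x); field.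
Qed.

Lemma is_derive_expR_affine (R : realType) (u v s : R) :
  is_derive s 1 (fun x => expR (u * x + v)) (u * expR (u * s + v)).
Proof.
apply: (is_derive_eq (is_derive1_comp (is_derive_expR _) (is_derive_affine u v s))).
by rewrite mulrC.
Qed.

Lemma is_derive_expRN_affine (R : realType) (u v s : R) :
  is_derive s 1 (fun x => expR (- (u * x + v))) (- (u * expR (- (u * s + v)))).
Proof.
have := is_derive_expR_affine (- u) (- v) s.
rewrite mulNr => h; rewrite -mulNr.
under eq_fun do rewrite opprD -mulNr.
by rewrite opprD -[X in expR (X + _)]mulNr mulNr.
Qed.

Lemma is_derive_coshR (R : realType) (A u v s : R) :
  is_derive s 1 (fun x => A * coshR (u * x + v)) (u * (A * sinhR (u * s + v))).
Proof.
apply: (is_derive_eq (is_deriveZ A (is_deriveM (is_deriveD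
  (is_derive_expR_affine u v s) (is_derive_expRN_affine u v s))
  (is_derive_cst (2^-1 : R) s (1 : R))))).
by rewrite /sinhR -![_ *: _]/(_ * _) /=; ring.
Qed.

Lemma is_derive_sinhR (R : realType) (A u v s : R) :
  is_derive s 1 (fun x => A * sinhR (u * x + v)) (u * (A * coshR (u * s + v))).
Proof.
apply: (is_derive_eq (is_deriveZ A (is_deriveM (is_deriveB
  (is_derive_expR_affine u v s) (is_derive_expRN_affine u v s))
  (is_derive_cst (2^-1 : R) s (1 : R))))).
by rewrite /coshR -![_ *: _]/(_ * _) /=; ring.
Qed.

Lemma frenet_timelike_unique (R : realType) n I (alpha : R -> 'cV[R]_n.+1) e eps
    kappa i j :
  I !=set0 -> frenet_curve I alpha e eps kappa ->
  (1 <= i <= n.+1)%N -> (1 <= j <= n.+1)%N -> eps i = -1 -> eps j = -1 -> i = j.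
Proof.
move=> [s Is] H Hi Hj ei ej; apply/eqP/contraT => /negPf ij.
pose d (l : 'I_n.+1) : R := if l == 0 then -1 else 1.
have d0 : d 0 = -1 by rewrite /d eqxx.
have d1 l : l != 0 -> d l = 1 by rewrite /d => /negPf ->.
have := timelike_not_orthogonal d0 d1 (u := fun l => e i s l 0) (v := fun l => e j s l 0).
rewrite -!ldotE !(frenet_orthonormal H) // !eqxx ei ej ij ltrN10 eqxx.
by move=> /(_ isT isT).
Qed.

(** * The norms of e_1, e_2 and e_3 as sums over the spectrum *)

Section Weights.
Variables (R : realType) (k : nat) (eps kt lam w : nat -> R).
Local Notation n := k.*2.
Local Notation node := (spiral_node k lam).
Hypotheses (k_ge1 : (1 <= k)%N)
  (eps_sqr : forall l, (1 <= l <= n.+1)%N -> eps l * eps l = 1)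
  (kt_neq0 : forall l, (1 <= l <= n)%N -> kt l != 0)
  (moments : forall a b, frame_dot eps (krylov n eps kt a) (krylov n eps kt b) =
    if odd (a + b) then 0
    else (-1) ^+ b * \sum_(i < k.+1) node i ^+ (a + b)./2 * w i).

Lemma sum_weights : \sum_(i < k.+1) w i = eps 1%N.
Proof.
have := frame_dot_krylov_ladder (i := 1) (j := 1) eps_sqr kt_neq0 isT isT.
rewrite /= moments /= mul1r => <-.
by apply: eq_bigr => i _; rewrite mul1r.
Qed.

Lemma sum_node_weights : - \sum_(i < k.+1) node i * w i = eps 2%N.
Proof.
have H2 : (1 <= 2 <= n.+1)%N by lia.
have := frame_dot_krylov_ladder (i := 2) (j := 2) eps_sqr kt_neq0 H2 H2.
rewrite /= /curvature_ratio /= mulr1 !scaler0 !add0r frame_dotZl frame_dotC frame_dotZl.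
rewrite moments /= expr1 mulN1r mulrA -expr2 exprVn expr2 eps_sqr // invr1 mul1r.
by under eq_bigr do rewrite expr1.
Qed.

(** Here kt_2 e_3 = eps_1 e_1 + eps_2 e_1'', whose component at node [i] is [u i] times eps_1 (1 -
    node i), because eps_1 eps_2 = -1. *)
Lemma sum_third_weights : eps 1%N * eps 2%N = -1 -> eps 3%N = 1 ->
  \sum_(i < k.+1) (1 - node i) ^+ 2 * w i = kt 2%N ^+ 2.
Proof.
move=> e12 e3.
have H2 : (1 <= 2 <= n.+1)%N by lia.
have H1 : (1 <= 1 <= n.+1)%N by lia.
have H3 : (1 <= 3 <= n.+1)%N by lia.
have k2 : kt 2%N != 0 by apply: kt_neq0; lia.
have := frame_dot_krylov_ladder (i := 3) (j := 3) eps_sqr kt_neq0 H3 H3.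
rewrite /= /curvature_ratio /= !mulr1 e3 mul1r !scaler0 !add0r.
rewrite frame_dotZl frame_dotC frame_dotZl mulrA.
have c1 : (eps 2%N)^-1 = eps 2%N by rewrite -[LHS]mulr1 -(eps_sqr H2) mulKf //;
  apply: contra_eq_neq (eps_sqr H2) => ->; rewrite mulr0 eq_sym oner_neq0.
rewrite c1 frame_dotDl !(frame_dotC _ _ (_ + _)) !frame_dotDl !frame_dotZl.
rewrite !(frame_dotC _ _ (_ *: _)) !frame_dotZl !moments /= !mul1r.
set S0 := \sum_(i < _) _; set S1 := \sum_(i < _) _; set S2 := \sum_(i < _) _.
move=> h.
have -> : kt 2%N ^+ 2 = eps 1 * (eps 1 * S0) + eps 1 * (eps 2 * S1)
   + (eps 2 * (eps 1 * S1) + eps 2 * (eps 2 * S2)).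
  by rewrite -[LHS]mulr1 -[X in _ * X]h; field.
have -> : eps 1 * (eps 1 * S0) + eps 1 * (eps 2 * S1)
   + (eps 2 * (eps 1 * S1) + eps 2 * (eps 2 * S2)) =
  (eps 1 * eps 1) * S0 + (eps 1 * eps 2) * S1 *+ 2 + (eps 2 * eps 2) * S2 by ring.
rewrite e12 !eps_sqr // !mul1r mulN1r /S0 /S1 /S2 -sumrN -sumrMnl -!big_split.
by apply: eq_bigr => i _ /=; ring.
Qed.

End Weights.

(** * The spiral as a model curve with the Frenet matrix of [alpha] *)

Section Realization.
Variables (R : realType) (k : nat) (I : set R)
  (alpha : R -> 'cV[R]_(k.*2.+1)) (e : nat -> R -> 'cV[R]_(k.*2.+1))
  (eps : nat -> R) (kappa : nat -> R -> R) (sigma : R -> R) (kt lam : nat -> R)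
  (m : nat) (a w : nat -> R) (x0 x1 : R -> R).
Local Notation n := k.*2.
Local Notation node := (spiral_node k lam).
Local Notation r := (curvature_ratio kt).
Local Notation c := (fun i => (eps i.+1 * r i)^-1).
Local Notation K := (krylov n eps kt).
Hypotheses (k_ge1 : (1 <= k)%N) (I_interval : is_interval I) (I_neq0 : I !=set0)
  (alpha_frenet : frenet_curve I alpha e eps kappa)
  (sigma_spherical : arc_length_parameter I (e 1%N) sigma)
  (kt_shape : forall i s, (1 <= i <= n)%N -> I s ->
     shape_curvature kappa sigma i s = kt i)
  (kt_neq0 : forall l, (1 <= l <= n)%N -> kt l != 0)
  (eps_m : forall l, (1 <= l <= n.+1)%N -> eps l = if l == m then -1 else 1)
  (m_le2 : (m <= 2)%N)
  (moments : forall p q, frame_dot eps (K p) (K q) =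
    if odd (p + q) then 0
    else (-1) ^+ q * \sum_(i < k.+1) node i ^+ (p + q)./2 * w i)
  (dx0 : forall s : R, is_derive s 1 x0 (lam 1%N * x1 s))
  (dx1 : forall s : R, is_derive s 1 x1 (lam 1%N * x0 s))
  (x_weight : forall s : R,
    (kt 1%N ^+ 2 - lam 1%N ^+ 2) * (x1 s ^+ 2 - x0 s ^+ 2) = w 0%N)
  (a_weight : forall i, (0 < i < k)%N -> a i.+1 ^+ 2 = w i)
  (a_weight_last : kt 1%N ^+ 2 * a k.+1 ^+ 2 = w k).
Local Notation v := (spiral_ladder k kt lam a x0 x1 eps).

Let eps_sqr l : (1 <= l <= n.+1)%N -> eps l * eps l = 1.
Proof. exact: (frenet_eps_sqr alpha_frenet). Qed.

Let kt1_neq0 : kt 1%N != 0.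
Proof. by apply: kt_neq0; lia. Qed.

Lemma spiral_ladder_orthonormal (t : R) i j : (1 <= i <= n.+1)%N ->
  (1 <= j <= n.+1)%N -> ldot (v i 0 t) (v j 0 t) = if i == j then eps i else 0.
Proof.
move=> Hi Hj; rewrite (spiral_ladder_gram k_ge1 (w := w)) //.
exact: frame_dot_krylov_ladder.
Qed.

(* The left-hand side is orthogonal to all the vectors of the frame. *)
Lemma spiral_ladder_last (t : R) :
  (eps n * r n) *: v n 0 t + v n.+1 1 t = 0.
Proof.
set x := _ + _.
have gram := frame_mx_gram (fun i j => @spiral_ladder_orthonormal t i j).
suff Fx : frame_mx ((v^~ 0%N)^~ t) *m (lorentz_mx R n *m x) = 0.
  have LF : lorentz_mx R n *m (frame_mx ((v^~ 0%N)^~ t))^T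
      *m diag_mx (\row_(j < n.+1) eps j.+1) *m frame_mx ((v^~ 0%N)^~ t) = 1%:M.
    apply: mulmx1C; rewrite !mulmxA gram; exact: (signs_mxK alpha_frenet).
  rewrite -[x]mul1mx -(lorentz_mxK R k) -mulmxA -[X in _ *m X]mul1mx -LF.
  by rewrite -(mulmxA _ (frame_mx _)) Fx !mulmx0.
apply/colP => i; rewrite [RHS]mxE.
transitivity (ldot (v i.+1 0 t) x).
  rewrite /ldot -mulmxA mxE [RHS]mxE; apply: eq_bigr => l _; congr (_ * _).
  by rewrite !mxE.
rewrite ldotC ldotDl ldotZl !(spiral_ladder_gram k_ge1 (w := w)) //.
rewrite -frame_dotZl -frame_dotDl ladder_krylov_last //; last by rewrite double_gt0.
exact: frame_dot0l.
Qed.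

(** All Frenet equations but the last hold by construction, each rung of the ladder being one of
    them solved for the next vector; the last is [spiral_ladder_last]. *)
Lemma spiral_frame_derive (t : R) :
  is_derive t 1 (fun x => frame_mx ((v^~ 0%N)^~ x))
    (frenet_mx n eps kt *m frame_mx ((v^~ 0%N)^~ t)).
Proof.
apply: is_derive_mx => i j.
have -> : (fun x => frame_mx ((v^~ 0%N)^~ x) i j) = (fun x => v i.+1 0 x j 0).
  by apply/funext => x; rewrite mxE.
have dv := spiral_ladder_derive kt a k_ge1 dx0 dx1 eps i.+1 0 t.
apply: (is_derive_eq (is_derive_coord j 0 dv)).
rewrite frenet_mx_mul_frame.
have Hi := ltn_ord i; rewrite ltnS in Hi.
have [i_n|n_i] := ltnP i n; last first.
  have -> : nat_of_ord i = n by lia.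
  rewrite double_gt0 k_ge1.
  have /eqP := spiral_ladder_last t; rewrite addrC addr_eq0 => /eqP ->.
  by rewrite !mxE sub0r.
have vE : v i.+2 0 t = c i.+1 *: ((eps i * r i) *: v i 0 t + v i.+1 1 t) by [].
have c0 : eps i.+2 * r i.+1 != 0 by apply: (ratio_neq0 (n := n)) => //; lia.
rewrite vE scalerA mulfV // scale1r.
have [i0|i0] := posnP i; last by rewrite [in RHS]mxE addrAC subrr add0r.
by rewrite i0 /= scaler0 add0r [X in _ - X]mxE subr0.
Qed.

Lemma spiral_realization :
  (forall i s, (1 <= i <= n.+1)%N ->
    ldot (spiral_frame m kt (spiral k kt lam a x0 x1) i s)
      (spiral_frame m kt (spiral k kt lam a x0 x1) i s) = eps i) /\
  exists f : psim R n, forall s, I s ->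
    psim_act f (alpha s) = spiral k kt lam a x0 x1 (sigma s).
Proof.
split=> [i s Hi|].
  rewrite (spiral_frameE _ _ k_ge1 dx0 dx1 eps_m m_le2); last lia.
  by rewrite spiral_ladder_orthonormal // eqxx.
apply: (congruent_model k_ge1 I_interval I_neq0 alpha_frenet sigma_spherical
  kt_shape (v := v^~ 0%N)).
- by move=> t i j; exact: spiral_ladder_orthonormal.
- exact: spiral_frame_derive.
- by move=> t; apply: spiral_derive.
Qed.

End Realization.

(** Square roots of the weights, with signs from [choose_signs]. The absolute value at 0 serves both
    causal cases; [t] is kt_1, by which the last amplitude is divided since the axis contributes
    kt_1^2 a_(k+1)^2. *)
Lemma exists_amplitudes (R : realType) k (w : nat -> R) (t : R) :
  (1 <= k)%N -> t != 0 -> w 0%N != 0 -> (forall i, (0 < i <= k)%N -> 0 < w i) ->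
  exists a : nat -> R,
    [/\ forall i, (1 <= i <= k.+1)%N -> a i != 0,
        different_up_to_triples k.+1 a,
        a 1%N ^+ 2 = `|w 0%N|,
        forall i, (0 < i < k)%N -> a i.+1 ^+ 2 = w i &
        t ^+ 2 * a k.+1 ^+ 2 = w k].
Proof.
move=> k_ge1 t0 w0 w_gt0.
pose c i := Num.sqrt `|w i.-1| / (if i == k.+1 then `|t| else 1).
have w_neq0 i : (i <= k)%N -> w i != 0.
  by case: i => // i Hi; rewrite gt_eqF // w_gt0.
have c_gt0 i : (1 <= i <= k.+1)%N -> 0 < c i.
  move=> Hi; rewrite divr_gt0 //; last by case: ifP => _; rewrite ?normr_gt0.
  by rewrite sqrtr_gt0 normr_gt0 w_neq0 //; lia.
have [a [abs_a a_diff]] := choose_signs c_gt0.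
have a_sqr i : (1 <= i <= k.+1)%N ->
    a i ^+ 2 = `|w i.-1| / (if i == k.+1 then t ^+ 2 else 1).
  move=> Hi; rewrite -real_normK ?num_real // abs_a // exprMn sqr_sqrtr // exprVn.
  by case: ifP => _; rewrite ?expr1n ?real_normK ?num_real.
exists a; split=> // [i Hi||i Hi|].
- by rewrite -normr_gt0 abs_a // c_gt0.
- by rewrite a_sqr //= eqSS ltn_eqF // divr1.
- by rewrite a_sqr /= ?eqSS ?ltn_eqF ?divr1 ?gtr0_norm ?w_gt0 //; lia.
- rewrite a_sqr ?eqxx ?leqnn //= mulrC divfK ?sqrf_eq0 // gtr0_norm // w_gt0 //.
  by rewrite k_ge1 leqnn.
Qed.

Lemma sum_amplitudes (R : realType) k (w a H : nat -> R) (t : R) : (1 <= k)%N ->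
  (forall i, (0 < i < k)%N -> a i.+1 ^+ 2 = w i) -> t ^+ 2 * a k.+1 ^+ 2 = w k ->
  \sum_(i < k.+1) H i * w i =
  H 0%N * w 0%N + \sum_(2 <= i < k.+1) H i.-1 * a i ^+ 2
    + H k * (t ^+ 2 * a k.+1 ^+ 2).
Proof.
case: k => // k _ aw ->; rewrite big_ord_recr big_ord_recl /=; congr (_ + _ + _).
rewrite big_add1 big_add1 big_mkord; apply: eq_bigr => i _ /=.
by rewrite aw //= ltnS ltn_ord.
Qed.

(** * The sign of the first weight and the two causal cases *)

Section SpiralCases.
Variables (R : realType) (k : nat) (I : set R)
    (alpha : R -> 'cV[R]_(k.*2.+1)) (e : nat -> R -> 'cV[R]_(k.*2.+1))
    (eps : nat -> R) (kappa : nat -> R -> R) (sigma : R -> R)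
    (kt lam : nat -> R).
Hypotheses (k_ge1 : (1 <= k)%N)
    (I_interval : is_interval I) (I_neq0 : I !=set0)
    (alpha_frenet : frenet_curve I alpha e eps kappa)
    (sigma_spherical : arc_length_parameter I (e 1%N) sigma)
    (kt_shape : forall i s, (1 <= i <= k.*2)%N -> I s ->
       shape_curvature kappa sigma i s = kt i)
    (kt_neq0 : forall i, (1 <= i <= k.*2)%N -> kt i != 0)
    (lam1_eigen : eigenvalue (frenet_mx k.*2 eps kt ^+ 2) (lam 1%N ^+ 2))
    (lam_eigen : forall i, (2 <= i <= k)%N ->
       eigenvalue (frenet_mx k.*2 eps kt ^+ 2) (- lam i ^+ 2))
    (lam_neq0 : forall i, (2 <= i <= k)%N -> lam i != 0)
    (lam_different : forall i j, (2 <= i <= k)%N -> (2 <= j <= k)%N ->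
       i <> j -> lam i ^+ 2 <> lam j ^+ 2)
    (lam1_gt0 : 0 < lam 1%N)
    (b1_real : 0 < lam 1%N ^+ 2 - kt 1%N ^+ 2).
Local Notation b1 := (spiral_b kt lam 1).
Local Notation node := (spiral_node k lam).

Lemma spiral_b1_sqr : b1 ^+ 2 = lam 1%N ^+ 2 - kt 1%N ^+ 2.
Proof. by rewrite /spiral_b eqxx sqr_sqrtr // ltW. Qed.

Lemma hyperbolic_weight (u x : R) : (kt 1%N ^+ 2 - lam 1%N ^+ 2) *
  ((u / b1 * coshR x) ^+ 2 - (u / b1 * sinhR x) ^+ 2) = - u ^+ 2.
Proof.
have -> : (u / b1 * coshR x) ^+ 2 - (u / b1 * sinhR x) ^+ 2 =
  (u / b1) ^+ 2 * (coshR x ^+ 2 - sinhR x ^+ 2) by ring.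
rewrite coshR_sinhR_sqr mulr1 exprMn exprVn spiral_b1_sqr.
by field; rewrite gt_eqF.
Qed.

Lemma single_timelike m l : (1 <= m <= k.*2.+1)%N -> eps m = -1 ->
  (1 <= l <= k.*2.+1)%N -> eps l = if l == m then -1 else 1.
Proof.
move=> Hm em Hl; have [->//|lm] := eqVneq l m.
have [//|el] := frenet_eps alpha_frenet Hl.
by move: lm; rewrite (frenet_timelike_unique I_neq0 alpha_frenet Hl Hm el em) eqxx.
Qed.

Lemma node_0 : node 0 = lam 1%N ^+ 2. Proof. by []. Qed.
Lemma node_last : node k = 0.
Proof. by rewrite /spiral_node eqxx gtn_eqF. Qed.
Lemma node_mid i : (2 <= i < k.+1)%N -> node i.-1 = - lam i ^+ 2.
Proof.
move=> Hi; rewrite /spiral_node prednK; last lia.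
have -> : (i.-1 == 0)%N = false by lia.
by have -> : (i.-1 == k)%N = false by lia.
Qed.

Lemma spectral_data m : (1 <= m <= 2)%N -> eps m = -1 ->
  exists w : nat -> R,
  [/\ forall i, (0 < i <= k)%N -> 0 < w i,
      forall p q, frame_dot eps (krylov k.*2 eps kt p) (krylov k.*2 eps kt q) =
        if odd (p + q) then 0
        else (-1) ^+ q * \sum_(i < k.+1) node i ^+ (p + q)./2 * w i,
      \sum_(i < k.+1) w i = eps 1%N,
      - \sum_(i < k.+1) node i * w i = eps 2%N &
      \sum_(i < k.+1) (1 - node i) ^+ 2 * w i = kt 2%N ^+ 2].
Proof.
move=> Hm em.
have Hm' : (1 <= m <= k.*2.+1)%N by lia.
have epsE := single_timelike Hm' em.
pose p : 'I_(k.*2.+1) := inord m.-1.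
have pE : p.+1 = m by rewrite /p inordK; lia.
have ep : eps p.+1 = -1 by rewrite pE.
have e_other (j : 'I_(k.*2.+1)) : j != p -> eps j.+1 = 1.
  by rewrite -val_eqE => jp; rewrite epsE ?ltn_ord // -pE eqSS (negPf jp).
have [w [w_gt0 moments]] := spectral_weights k_ge1 ep e_other kt_neq0 lam1_eigen
  lam_eigen lam_neq0 lam_different (lt0r_neq0 lam1_gt0).
have eps_sqr := frenet_eps_sqr alpha_frenet.
exists w; split => //.
- exact: (sum_weights eps_sqr kt_neq0 moments).
- exact: (sum_node_weights k_ge1 eps_sqr kt_neq0 moments).
- have H3 : (1 <= 3 <= k.*2.+1)%N by lia.
  have H2 : (1 <= 2 <= k.*2.+1)%N by lia.
  apply: (sum_third_weights k_ge1 eps_sqr kt_neq0 moments).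
  + rewrite !epsE //; have : m = 1%N \/ m = 2%N by lia.
    by case=> -> /=; rewrite ?mulr1 ?mul1r.
  + by rewrite epsE // gtn_eqF //; lia.
Qed.

Lemma timelike_case : eps 1%N = -1 ->
     exists a : nat -> R,
       [/\ forall i, (1 <= i <= k.+1)%N -> a i != 0,
           different_up_to_triples k.+1 a,
           timelike_system k kt lam a &
           exists f : psim R k.*2, forall s, I s ->
             psim_act f (alpha s) = timelike_spiral k kt lam a (sigma s)].
Proof.
move=> e1.
have [w [w_gt0 moments W0 W1 W2]] := spectral_data (m := 1) isT e1.
have kt1_neq0 : kt 1%N != 0 by apply: kt_neq0; lia.
(* The weights add up to eps_1 = -1 and all others are positive. *)
have w0_lt0 : w 0%N < 0.
  have : 0 <= \sum_(i < k) w i.+1.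
    by apply: sumr_ge0 => i _; rewrite ltW // w_gt0 //= ltn_ord.
  by move: W0; rewrite big_ord_recl e1 /=; lra.
have [a [a_neq0 a_diff a1 a_mid a_last]] :=
  exists_amplitudes k_ge1 kt1_neq0 (ltr0_neq0 w0_lt0) w_gt0.
rewrite ltr0_norm // in a1.
have eps1 l Hl : eps l = if l == 1%N then -1 else 1 :=
  single_timelike (m := 1) isT e1 Hl.
have sums H := sum_amplitudes H k_ge1 a_mid a_last.
have sum1 : eps 1%N = w 0%N + \sum_(2 <= i < k.+1) a i ^+ 2
    + kt 1%N ^+ 2 * a k.+1 ^+ 2.
  rewrite -W0 -[w 0%N]mul1r -[_ ^+ 2 * _]mul1r.
  under eq_bigr do rewrite -[w _]mul1r.
  under [in RHS]eq_bigr do rewrite -[_ ^+ 2]mul1r.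
  exact: (sums (fun=> 1)).
have x_weight s : (kt 1%N ^+ 2 - lam 1%N ^+ 2) *
    ((a 1%N / b1 * coshR (spiral_theta kt lam 1%N s)) ^+ 2 -
     (a 1%N / b1 * sinhR (spiral_theta kt lam 1%N s)) ^+ 2) = w 0%N.
  by rewrite hyperbolic_weight a1 opprK.
have [frame_sqr congruent] := spiral_realization k_ge1 I_interval I_neq0
  alpha_frenet sigma_spherical kt_shape kt_neq0 eps1 isT moments
  (fun s => is_derive_sinhR _ _ _ _) (fun s => is_derive_coshR _ _ _ _)
  x_weight a_mid a_last.
exists a; split=> //; split.
- by move=> i s Hi; rewrite [LHS]frame_sqr ?eps1 //; lia.
- by rewrite a1 opprK -sum1 e1.
- have e2 : eps 2%N = 1 by rewrite eps1 //; lia.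
  rewrite big_ltn // a1; move: W1; rewrite (sums node) node_0 node_last e2.
  rewrite mul0r addr0 => <-.
  rewrite opprD -sumrN -mulrN mulrC; congr (_ + _).
  by apply: eq_big_nat => i Hi; rewrite node_mid //; ring.
- rewrite a1 opprK; move: W2; rewrite (sums (fun i => (1 - node i) ^+ 2)).
  rewrite node_0 node_last subr0 expr1n mul1r => <-.
  rewrite mulrC; congr (_ + _ + _).
  by apply: eq_big_nat => i Hi; rewrite node_mid // opprK.
Qed.

Lemma spacelike_case : eps 2%N = -1 ->
     exists a : nat -> R,
       [/\ forall i, (1 <= i <= k.+1)%N -> a i != 0,
           different_up_to_triples k.+1 a,
           spacelike_system k kt lam a &
           exists f : psim R k.*2, forall s, I s ->
             psim_act f (alpha s) = spacelike_spiral k kt lam a (sigma s)].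
Proof.
move=> e2.
have [w [w_gt0 moments W0 W1 W2]] := spectral_data (m := 2) isT e2.
have kt1_neq0 : kt 1%N != 0 by apply: kt_neq0; lia.
(* In the sum for eps_2 = -1 the terms after the first are nonnegative, as their nodes are at most
   0. Hence lam_1^2 [w 0] is at least 1. *)
have w0_gt0 : 0 < w 0%N.
  have : 0 <= \sum_(i < k) - (node i.+1 * w i.+1).
    apply: sumr_ge0 => i _; rewrite -mulNr mulr_ge0 //; last first.
      by rewrite ltW // w_gt0 //= ltn_ord.
    have [ik|ik] := eqVneq i.+1 k; first by rewrite ik node_last oppr0.
    have Hi := ltn_ord i.
    by rewrite (node_mid (i := i.+2)) ?opprK ?sqr_ge0 //; lia.
  rewrite sumrN => h; rewrite -(pmulr_rgt0 _ (exprn_gt0 2 lam1_gt0)).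
  by move: W1; rewrite big_ord_recl e2 node_0 /=; lra.
have [a [a_neq0 a_diff a1 a_mid a_last]] :=
  exists_amplitudes k_ge1 kt1_neq0 (lt0r_neq0 w0_gt0) w_gt0.
rewrite gtr0_norm // in a1.
have H2 : (1 <= 2 <= k.*2.+1)%N by lia.
have eps2 l Hl : eps l = if l == 2%N then -1 else 1 :=
  single_timelike (m := 2) H2 e2 Hl.
have sums H := sum_amplitudes H k_ge1 a_mid a_last.
have sum1 : eps 1%N = w 0%N + \sum_(2 <= i < k.+1) a i ^+ 2
    + kt 1%N ^+ 2 * a k.+1 ^+ 2.
  rewrite -W0 -[w 0%N]mul1r -[_ ^+ 2 * _]mul1r.
  under eq_bigr do rewrite -[w _]mul1r.
  under [in RHS]eq_bigr do rewrite -[_ ^+ 2]mul1r.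
  exact: (sums (fun=> 1)).
(* With cosh on the time axis x1^2 - x0^2 has the opposite sign to the timelike case, which fits
   [w 0] = a_1^2 > 0. *)
have x_weight s : (kt 1%N ^+ 2 - lam 1%N ^+ 2) *
    ((- (a 1%N / b1 * sinhR (spiral_theta kt lam 1%N s))) ^+ 2 -
     (- (a 1%N / b1 * coshR (spiral_theta kt lam 1%N s))) ^+ 2) = w 0%N.
  by rewrite !sqrrN -[X in _ * X]opprB mulrN hyperbolic_weight a1 opprK.
have dx0 (s : R) : is_derive s 1
    (fun s => - (a 1%N / b1 * coshR (spiral_theta kt lam 1%N s)))
    (lam 1%N * - (a 1%N / b1 * sinhR (spiral_theta kt lam 1%N s))).
  by rewrite mulrN; apply: is_deriveN; exact: is_derive_coshR.
have dx1 (s : R) : is_derive s 1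
    (fun s => - (a 1%N / b1 * sinhR (spiral_theta kt lam 1%N s)))
    (lam 1%N * - (a 1%N / b1 * coshR (spiral_theta kt lam 1%N s))).
  by rewrite mulrN; apply: is_deriveN; exact: is_derive_sinhR.
have [frame_sqr congruent] := spiral_realization k_ge1 I_interval I_neq0
  alpha_frenet sigma_spherical kt_shape kt_neq0 eps2 isT moments
  dx0 dx1 x_weight a_mid a_last.
have e1 : eps 1%N = 1 by rewrite eps2.
exists a; split=> //; split.
- by move=> i s Hi; rewrite [LHS]frame_sqr ?eps2 //; lia.
- by rewrite big_ltn // a1 -sum1 e1.
- rewrite a1; move: W1; rewrite (sums node) node_0 node_last e2.
  rewrite mul0r addr0 => <-.
  rewrite opprD -sumrN mulNr mulrC; congr (_ + _).
  by apply: eq_big_nat => i Hi; rewrite node_mid //; ring.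
- rewrite a1; move: W2; rewrite (sums (fun i => (1 - node i) ^+ 2)).
  rewrite node_0 node_last subr0 expr1n mul1r => <-.
  rewrite mulrC; congr (_ + _ + _).
  by apply: eq_big_nat => i Hi; rewrite node_mid // opprK.
Qed.

End SpiralCases.

Theorem theorem15 (R : realType) (k : nat) (I : set R)
    (alpha : R -> 'cV[R]_(k.*2.+1)) (e : nat -> R -> 'cV[R]_(k.*2.+1))
    (eps : nat -> R) (kappa : nat -> R -> R) (sigma : R -> R)
    (kt lam : nat -> R)
    (k_ge1 : (1 <= k)%N)
    (I_interval : is_interval I) (I_open : open I) (I_neq0 : I !=set0)
    (alpha_frenet : frenet_curve I alpha e eps kappa)
    (sigma_spherical : arc_length_parameter I (e 1%N) sigma)
    (alpha_self_similar : self_similar I alpha)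
    (kt_shape : forall i s, (1 <= i <= k.*2)%N -> I s ->
       shape_curvature kappa sigma i s = kt i)
    (kt_neq0 : forall i, (1 <= i <= k.*2)%N -> kt i != 0)
    (lam1_eigen : eigenvalue (frenet_mx k.*2 eps kt ^+ 2) (lam 1%N ^+ 2))
    (lam_eigen : forall i, (2 <= i <= k)%N ->
       eigenvalue (frenet_mx k.*2 eps kt ^+ 2) (- lam i ^+ 2))
    (lam_neq0 : forall i, (2 <= i <= k)%N -> lam i != 0)
    (lam_different : forall i j, (2 <= i <= k)%N -> (2 <= j <= k)%N ->
       i <> j -> lam i ^+ 2 <> lam j ^+ 2)
    (lam1_gt0 : 0 < lam 1%N)
    (b1_real : 0 < lam 1%N ^+ 2 - kt 1%N ^+ 2) :
  (eps 1%N = -1 ->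
     exists a : nat -> R,
       [/\ forall i, (1 <= i <= k.+1)%N -> a i != 0,
           different_up_to_triples k.+1 a,
           timelike_system k kt lam a &
           exists f : psim R k.*2, forall s, I s ->
             psim_act f (alpha s) = timelike_spiral k kt lam a (sigma s)])
  /\
  (eps 2%N = -1 ->
     exists a : nat -> R,
       [/\ forall i, (1 <= i <= k.+1)%N -> a i != 0,
           different_up_to_triples k.+1 a,
           spacelike_system k kt lam a &
           exists f : psim R k.*2, forall s, I s ->
             psim_act f (alpha s) = spacelike_spiral k kt lam a (sigma s)]).
Proof.
split; first exact: (timelike_case k_ge1 I_interval I_neq0 alpha_frenet
  sigma_spherical kt_shape kt_neq0 lam1_eigen lam_eigen lam_neq0 lam_different).
exact: (spacelike_case k_ge1 I_interval I_neq0 alpha_frenet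
  sigma_spherical kt_shape kt_neq0 lam1_eigen lam_eigen lam_neq0 lam_different).
Qed.
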